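(* Let $n\ge2$. The collection $\{\mathrm{SDT}(\lambda)\otimes\mathcal T_{-\lambda}\}_{\lambda\in\Lambda^-}$, together with the inclusion maps $\upsilon_{\lambda,\lambda+\mu}$ ($\lambda,\mu\in\Lambda^-$) described in the context, forms a directed system.
   Context: **Notation.** $I_0=\{1,\dots,n-1\}$, $I=I_0\sqcup\{\overline1\}$; $\epsilon_1,\dots,\epsilon_n$ is the standard basis of $\mathbb{Z}^n$; $\alpha_i=\epsilon_i-\epsilon_{i+1}$ for $i\in I_0$. $\Lambda^-$ is the set of $\lambda=-\lambda_1\epsilon_1-\cdots-\lambda_n\epsilon_n\in\mathbb Z^n_{\le0}$ such that for $1\le i\le n-1$, $\lambda_i\ge\lambda_{i+1}$, and $\lambda_i=\lambda_{i+1}$ implies $\lambda_i=\lambda_{i+1}=0$. It is partially ordered by $\lambda\le\mu$ iff $\mu-\lambda\in\Lambda^-$. An element $\lambda\in\Lambda^-$ is identified with the strict partition $w_0\lambda=(\lambda_n,\dots,\lambda_1)$; $\ell(\lambda)$ is the number of nonzero $\lambda_i$. **Crystals.** An abstract $\mathfrak{gl}(n)$-crystal is a set $\mathcal B$ with maps $e_i,f_i:\mathcal B\to\mathcal B\sqcup\{\mathbf 0\}$, $\varepsilon_i,\varphi_i:\mathcal B\to\mathbb Z\sqcup\{-\infty\}$ ($i\in I_0$) and $\mathrm{wt}:\mathcal B\to\mathbb Z^n$ such that, for $i\in I_0$ and $b,b'\in\mathcal B$: $\mathrm{wt}(e_ib)=\mathrm{wt}(b)+\alpha_i$ if $e_ib\ne\mathbf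 0$; $\mathrm{wt}(f_ib)=\mathrm{wt}(b)-\alpha_i$ if $f_ib\neq\mathbf 0$; $\varphi_i(b)=\varepsilon_i(b)+\mathrm{wt}_i(b)$, where $\mathrm{wt}_i(b)=\mu_i-\mu_{i+1}$ if $\mathrm{wt}(b)=\sum_j\mu_j\epsilon_j$; $f_ib=b'$ iff $b=e_ib'$; if $e_ib\ne\mathbf 0$ then $\varepsilon_i(e_ib)=\varepsilon_i(b)-1$ and $\varphi_i(e_ib)=\varphi_i(b)+1$; if $f_ib\ne\mathbf 0$ then $\varepsilon_i(f_ib)=\varepsilon_i(b)+1$ and $\varphi_i(f_ib)=\varphi_i(b)-1$; if $\varphi_i(b)=-\infty$ then $e_ib=f_ib=\mathbf 0$. An abstract $\mathfrak q(n)$-crystal is an abstract $\mathfrak{gl}(n)$-crystal $\mathcal B$ with further maps $e_{\overline1},f_{\overline1}:\mathcal B\to\mathcal B\sqcup\{\mathbf 0\}$ such that: $\mathrm{wt}(\mathcal B)\subset\mathbb Z^n_{\ge0}$; $\mathrm{wt}(e_{\overline1}b)=\mathrm{wt}(b)+\alpha_1$ if $e_{\overline1}b\ne\mathbf0$; $\mathrm{wt}(f_{\overline1}b)=\mathrm{wt}(b)-\alpha_1$ if $f_{\overline1}b\neq\mathbf0$; $f_{\overline1}b=b'$ iff $b=e_{\overline1}b'$ for $b,b'\in\mathcal B$; and for $3\le i\le n-1$, $e_{\overline1},f_{\overline1}$ commute with $e_i,f_i$, and $\varepsilon_i(e_{\overline1}b)=\varepsilon_i(b)$, $\varphi_i(e_{\overline1}b)=\varphi_i(b)$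 whenever $e_{\overline1}b\in\mathcal B$. A crystal morphism is a map $\psi:\mathcal B\to\mathcal C\sqcup\{\mathbf0\}$ (with $\psi(\mathbf 0)=\mathbf 0$) such that if $b\in\mathcal B$ and $\psi(b)\in\mathcal C$ it preserves $\mathrm{wt},\varepsilon_i,\varphi_i$ ($i\in I_0$), and for all $i\in I$: $\psi(e_ib)=e_i\psi(b)$ provided $\psi(e_ib)\ne\mathbf0$ and $e_i\psi(b)\ne\mathbf0$, and likewise for $f_i$. It is an embedding if the induced map $\mathcal B\sqcup\{\mathbf0\}\to\mathcal C\sqcup\{\mathbf0\}$ is injective. A directed system of crystals is a family $\{\mathcal B_j\}_{j\in J}$ of abstract $\mathfrak q(n)$-crystals indexed by a directed poset $J$, with crystal embeddings $\psi_{k,j}:\mathcal B_j\to\mathcal B_k$ for $j\le k$ such that $\psi_{j,j}$ is the identity and $\psi_{k,j}\psi_{j,i}=\psi_{k,i}$ for $i\le j\le k$. Here $J=\Lambda^-$ with the order above, and the embedding for $\lambda\le\lambda+\mu$ is $\upsilon_{\lambda,\lambda+\mu}$. **Tensor products.** $\mathcal B\otimes\mathcal C$ is $\mathcal B\times\mathcal C$ with, for $i\in I_0$: $e_i(b\otimes c)=e_ib\otimes c$ if $\varphi_i(c)<\varepsilon_i(b)$, and $b\otimes e_ic$ otherwise; $f_i(b\otimes c)=f_ib\otimes c$ if $\varphi_i(c)\le\varepsilon_i(b)$, and $b\otimes f_ic$ otherwise; $e_{\overline1}(b\otimes c)=b\otimes e_{\overline1}c$ if $e_{\overline1}b=f_{\overline1}b=\mathbf0$,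 and $e_{\overline1}b\otimes c$ otherwise; $f_{\overline1}(b\otimes c)=b\otimes f_{\overline1}c$ if $e_{\overline1}b=f_{\overline1}b=\mathbf0$, and $f_{\overline1}b\otimes c$ otherwise; $\varepsilon_i(b\otimes c)=\max(\varepsilon_i(c),\varepsilon_i(b)-\mathrm{wt}_i(c))$, $\varphi_i(b\otimes c)=\max(\varphi_i(b),\varphi_i(c)+\mathrm{wt}_i(b))$, $\mathrm{wt}(b\otimes c)=\mathrm{wt}(b)+\mathrm{wt}(c)$. (Tensors with a factor $\mathbf0$ are $\mathbf0$.) For $\nu\in\mathbb Z^n$, $\mathcal T_\nu=\{t_\nu\}$ with $e_it_\nu=f_it_\nu=\mathbf0$ for all $i\in I$, $\varepsilon_i(t_\nu)=\varphi_i(t_\nu)=-\infty$ for $i\in I_0$, and $\mathrm{wt}(t_\nu)=\nu$. **Tableaux.** A word $u_1\cdots u_N$ is a hook word if $u_1\ge\cdots\ge u_k<u_{k+1}<\cdots<u_N$ for some $1\le k\le N$. For $\lambda\in\Lambda^-$, consider the shifted Young diagram whose $k$-th row from the top has $\lambda_k$ cells and is shifted $k-1$ units to the right (the shape $w_0\lambda$). $\mathrm{SDT}(\lambda)$ is the set of semistandard decomposition tableaux of this shape: fillings with letters in $\{1,\dots,n\}$ such that, with $v_k$ the word formed by reading the $k$-th row (from the top) left to right, each $v_k$ is a hook word, and $v_k$ is a hook subword of maximal length in $v_{k+1}v_k$ for $1\le k\le\ell(\lambda)-1$, where the entries of $v_k$ are taken consecutively. $\mathrm{rd}(T)$ is the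 word obtained by reading each row from right to left, starting with the top row; $\mathrm{rd}_i(T)$ is its subword consisting of the letters $i,i+1$; $\overline{\mathrm{rd}}_i(T)$ is obtained from it by successively removing all pairs $(i+1,i)$ (in that order), so it consists of $i$'s followed by $(i+1)$'s. $L^\lambda\in\mathrm{SDT}(\lambda)$ is the tableau whose $i$-th row from the bottom contains only the letter $i$. Crystal structure on $\mathrm{SDT}(\lambda)$: for $i\in I_0$, $e_iT$ changes to $i$ the box of the leftmost $i+1$ of $\overline{\mathrm{rd}}_i(T)$ ($\mathbf0$ if none); $f_iT$ changes to $i+1$ the box of the rightmost $i$ of $\overline{\mathrm{rd}}_i(T)$ ($\mathbf 0$ if none). If the leftmost letter of $\mathrm{rd}_1(T)$ is $1$, then $e_{\overline1}T=\mathbf0$ and $f_{\overline1}T$ changes that box to $2$; if it is $2$, then $f_{\overline1}T=\mathbf0$ and $e_{\overline1}T$ changes that box to $1$; if $\mathrm{rd}_1(T)$ is empty, both are $\mathbf0$. $\varepsilon_i(T)$ and $\varphi_i(T)$ are the numbers of $(i+1)$'s and of $i$'s in $\overline{\mathrm{rd}}_i(T)$; $\mathrm{wt}(T)=\sum_j(\#j\text{ in }T)\epsilon_j$. **The maps.** For $\lambda,\mu\in\Lambda^-$, $\upsilon_{\lambda,\lambda+\mu}:\mathrm{SDT}(\lambda)\otimes\mathcal T_{-\lambda}\hookrightarrow\mathrm{SDT}(\lambda+\mu)\otimes\mathcal T_{-\lambda-\mu}$ is the $\mathfrak q(n)$-crystal embedding $T\otimes t_{-\lambda}\mapsto E(T)\otimes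 t_{-\lambda-\mu}$, where $E(T)$ is obtained from $T$ by adding $\mu_{n+1-i}$ boxes with entry $i$ on the left of row $n+1-i$ (counted from the top), for each $1\le i\le n$, where $\mu=-\sum_k\mu_k\epsilon_k$. It sends $L^{\lambda}\otimes t_{-\lambda}$ to $L^{\lambda+\mu}\otimes t_{-\lambda-\mu}$.
   Formalization: The weight of t_{-λ} is taken to be -(λ_n,…,λ_1) instead of -λ, and the condition that weights lie in Z^n_{≥0} is replaced by its translate by wt(t_{-λ}); as literally stated, υ does not preserve weights, or the members have weights with negative entries. *)

(* Defs.v *)
From HB Require Import structures.
From mathcomp Require Import all_boot all_order all_algebra.

Set Implicit Arguments.
Unset Strict Implicit.
Unset Printing Implicit Defensive.

Import Order.TTheory GRing.Theory Num.Theory.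

(* Indices are 0-based: the letter a (0 <= a < n) stands for the letter a + 1
   of the usual alphabet {1, ..., n}, the row k of a tableau for its (k+1)-st
   row, and i : 'I_n.-1 for the index i + 1 of I_0 = {1, ..., n-1}. *)

(* Z together with -oo, which is None. *)
Definition zninf := option int.

Definition zle (x y : zninf) : bool :=
  match x, y with
  | None, _ => true
  | Some _, None => false
  | Some a, Some b => (a <= b)%R
  end.
Definition zlt (x y : zninf) : bool := ~~ zle y x.
Definition zmax (x y : zninf) : zninf := if zle x y then y else x.
Definition zadd (x : zninf) (z : int) : zninf :=
  omap (fun a : int => (a + z)%R) x.

Section Weights.
Local Open Scope ring_scope.
Variable n : nat.

Lemma ihi_subproof (i : 'I_n.-1) : (i.+1 < n)%N.
Proof. by rewrite -ltn_predRL. Qed.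

Definition ilo (i : 'I_n.-1) : 'I_n := widen_ord (leq_pred n) i.
Definition ihi (i : 'I_n.-1) : 'I_n := Ordinal (ihi_subproof i).

Definition alpha (k : nat) : 'rV[int]_n :=
  \row_j ((j == k :> nat)%:R - (j == k.+1 :> nat)%:R).

Definition wti (i : 'I_n.-1) (mu : 'rV[int]_n) : int :=
  mu 0 (ilo i) - mu 0 (ihi i).

End Weights.

(* The index set I is option 'I_n.-1, where None is the queer index 1bar. In
   maps into B \sqcup {0}, the element 0 is None. *)
Record crystal (n : nat) := Crystal {
  cr_sort :> Type;
  cr_e : option 'I_n.-1 -> cr_sort -> option cr_sort;
  cr_f : option 'I_n.-1 -> cr_sort -> option cr_sort;
  cr_eps : 'I_n.-1 -> cr_sort -> zninf;
  cr_phi : 'I_n.-1 -> cr_sort -> zninf;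
  cr_wt : cr_sort -> 'rV[int]_n
}.
Arguments cr_e {n c}.
Arguments cr_f {n c}.
Arguments cr_eps {n c}.
Arguments cr_phi {n c}.
Arguments cr_wt {n c}.

Definition simple_root (n : nat) (i : option 'I_n.-1) : 'rV[int]_n :=
  if i is Some k then alpha n k else alpha n 0.

Record is_gl_crystal (n : nat) (B : crystal n) : Prop := IsGlCrystal {
  gl_wt_e : forall (i : 'I_n.-1) (b b' : B), cr_e (Some i) b = Some b' ->
    cr_wt b' = (cr_wt b + simple_root (Some i))%R;
  gl_wt_f : forall (i : 'I_n.-1) (b b' : B), cr_f (Some i) b = Some b' ->
    cr_wt b' = (cr_wt b - simple_root (Some i))%R;
  gl_phi_eps : forall (i : 'I_n.-1) (b : B),
    cr_phi i b = zadd (cr_eps i b) (wti i (cr_wt b));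
  gl_fe : forall (i : 'I_n.-1) (b b' : B),
    cr_f (Some i) b = Some b' <-> cr_e (Some i) b' = Some b;
  gl_eps_e : forall (i : 'I_n.-1) (b b' : B), cr_e (Some i) b = Some b' ->
    cr_eps i b' = zadd (cr_eps i b) (-1) /\ cr_phi i b' = zadd (cr_phi i b) 1;
  gl_eps_f : forall (i : 'I_n.-1) (b b' : B), cr_f (Some i) b = Some b' ->
    cr_eps i b' = zadd (cr_eps i b) 1 /\ cr_phi i b' = zadd (cr_phi i b) (-1);
  gl_ninf : forall (i : 'I_n.-1) (b : B), cr_phi i b = None ->
    cr_e (Some i) b = None /\ cr_f (Some i) b = None
}.

(* is_q_crystal 0 B says that B is an abstract q(n)-crystal. For general nu,
   the condition that all weights lie in Z^n_{>= 0} is replaced by its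
   translate nu + Z^n_{>= 0}: this is what it becomes for C \otimes T_nu, with
   C an abstract q(n)-crystal, since tensoring with T_nu translates weights
   by nu. *)
Record is_q_crystal (n : nat) (nu : 'rV[int]_n) (B : crystal n) : Prop :=
    IsQCrystal {
  q_gl : is_gl_crystal B;
  q_wt_ge : forall (b : B) (j : 'I_n), (nu 0 j <= cr_wt b 0 j)%R;
  q_wt_e : forall b b' : B, cr_e None b = Some b' ->
    cr_wt b' = (cr_wt b + simple_root None)%R;
  q_wt_f : forall b b' : B, cr_f None b = Some b' ->
    cr_wt b' = (cr_wt b - simple_root None)%R;
  q_fe : forall b b' : B, cr_f None b = Some b' <-> cr_e None b' = Some b;
  q_comm : forall (i : 'I_n.-1) (b : B), (2 <= i)%N ->
    [/\ obind (cr_e (Some i)) (cr_e None b) = obind (cr_e None) (cr_e (Some i) b),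
        obind (cr_f (Some i)) (cr_e None b) = obind (cr_e None) (cr_f (Some i) b),
        obind (cr_e (Some i)) (cr_f None b) = obind (cr_f None) (cr_e (Some i) b) &
        obind (cr_f (Some i)) (cr_f None b) = obind (cr_f None) (cr_f (Some i) b)];
  q_eps : forall (i : 'I_n.-1) (b b' : B), (2 <= i)%N ->
    cr_e None b = Some b' -> cr_eps i b' = cr_eps i b /\ cr_phi i b' = cr_phi i b
}.

Record is_morphism (n : nat) (B C : crystal n) (psi : B -> option C) : Prop :=
    IsMorphism {
  mor_wt : forall (b : B) (c : C), psi b = Some c -> cr_wt c = cr_wt b;
  mor_eps : forall (i : 'I_n.-1) (b : B) (c : C), psi b = Some c ->
    cr_eps i c = cr_eps i b /\ cr_phi i c = cr_phi i b;
  mor_e : forall (i : option 'I_n.-1) (b : B),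
    obind psi (cr_e i b) <> None -> obind (cr_e i) (psi b) <> None ->
    obind psi (cr_e i b) = obind (cr_e i) (psi b);
  mor_f : forall (i : option 'I_n.-1) (b : B),
    obind psi (cr_f i b) <> None -> obind (cr_f i) (psi b) <> None ->
    obind psi (cr_f i b) = obind (cr_f i) (psi b)
}.

Definition is_embedding (n : nat) (B C : crystal n) (psi : B -> option C) : Prop :=
  is_morphism psi /\ injective (obind psi : option B -> option C).

Definition directed_poset (J : Type) (le : rel J) : Prop :=
  [/\ inhabited J,
      reflexive le,
      (forall j k, le j k -> le k j -> j = k),
      transitive le &
      forall j k, exists l, le j l /\ le k l].

(* A directed system with the weights of B j in nu j + Z^n_{>= 0}. *)
Record directed_system (n : nat) (J : Type) (le : rel J)
    (nu : J -> 'rV[int]_n) (B : J -> crystal n)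
    (psi : forall j k : J, le j k -> B j -> option (B k)) : Prop :=
    DirectedSystem {
  ds_poset : directed_poset le;
  ds_crystal : forall j, is_q_crystal (nu j) (B j);
  ds_embedding : forall j k (jk : le j k), is_embedding (psi j k jk);
  ds_id : forall j (jj : le j j) (b : B j), psi j j jj b = Some b;
  ds_comp : forall i j k (ij : le i j) (jk : le j k) (ik : le i k) (b : B i),
    obind (psi j k jk) (psi i j ij b) = psi i k ik b
}.

Section Tensor.
Variables (n : nat) (B C : crystal n).

Definition tensl (ob : option B) (c : C) : option (B * C) :=
  omap (fun b => (b, c)) ob.
Definition tensr (b : B) (oc : option C) : option (B * C) :=
  omap (fun c => (b, c)) oc.

Definition queer_free (b : B) : bool := ~~ cr_e None b && ~~ cr_f None b.

Definition tens_e (i : option 'I_n.-1) (x : B * C) : option (B * C) :=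
  let: (b, c) := x in
  match i with
  | Some k => if zlt (cr_phi k c) (cr_eps k b) then tensl (cr_e i b) c
              else tensr b (cr_e i c)
  | None => if queer_free b then tensr b (cr_e None c)
            else tensl (cr_e None b) c
  end.

Definition tens_f (i : option 'I_n.-1) (x : B * C) : option (B * C) :=
  let: (b, c) := x in
  match i with
  | Some k => if zle (cr_phi k c) (cr_eps k b) then tensl (cr_f i b) c
              else tensr b (cr_f i c)
  | None => if queer_free b then tensr b (cr_f None c)
            else tensl (cr_f None b) c
  end.

Definition tensor : crystal n :=
  Crystal tens_e tens_f
    (fun i x => zmax (cr_eps i x.2) (zadd (cr_eps i x.1) (- wti i (cr_wt x.2))))
    (fun i x => zmax (cr_phi i x.1) (zadd (cr_phi i x.2) (wti i (cr_wt x.1))))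
    (fun x => (cr_wt x.1 + cr_wt x.2)%R).

End Tensor.

Definition Tcrystal (n : nat) (nu : 'rV[int]_n) : crystal n :=
  @Crystal n unit (fun _ _ => None) (fun _ _ => None)
    (fun _ _ => None) (fun _ _ => None) (fun _ => nu).

Section LambdaNeg.
Local Open Scope ring_scope.
Variable n : nat.

(* A row vector v is the weight - lambda_1 epsilon_1 - ... - lambda_n epsilon_n
   with lambda_(k+1) = - v 0 k. *)
Definition lambda_neg (v : 'rV[int]_n) : bool :=
  [forall k, v 0 k <= 0] &&
  [forall i : 'I_n.-1,
    (- v 0 (ihi i) <= - v 0 (ilo i)) &&
    ((v 0 (ilo i) == v 0 (ihi i)) ==> ((v 0 (ilo i) == 0) && (v 0 (ihi i) == 0)))].

Definition LambdaNeg := {v : 'rV[int]_n | lambda_neg v}.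

Definition lambda_le : rel LambdaNeg :=
  fun lam mu => lambda_neg (val mu - val lam).

(* the row lengths (lambda_1, ..., lambda_n) *)
Definition parts (v : 'rV[int]_n) : seq nat :=
  [seq absz (v 0 k) | k <- enum 'I_n].

(* The vector (lambda_n, ..., lambda_1) with which lambda is identified. It is
   the weight of the tableau of shape lambda whose k-th row from the top only
   contains the letter n + 1 - k. *)
Definition w0_parts (lam : LambdaNeg) : 'rV[int]_n :=
  \row_j - val lam 0 (rev_ord j).

End LambdaNeg.

(* w_1 >= ... >= w_k < w_(k+1) < ... < w_N, where the index of the bounded
   quantifier is k - 1. *)
Definition hook_word (w : seq nat) : bool :=
  [exists k : 'I_(size w), sorted geq (take k.+1 w) && sorted ltn (drop k w)].

(* The hook subwords of w, not necessarily made of consecutive letters, have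
   length at most m. *)
Definition max_hook (w : seq nat) (m : nat) : bool :=
  [forall s : (size w).-tuple bool,
    hook_word (mask s w) ==> (size (mask s w) <= m)].

(* A tableau is the sequence of its n rows from top to bottom; rows beyond
   the length of the shape are empty. The shift of the rows is determined by
   the shape and not recorded. The last condition is void for an empty row
   k + 1, given that the row k is a hook word. *)
Definition is_SDT (n : nat) (v : 'rV[int]_n) (T : seq (seq nat)) : bool :=
  [&& shape T == parts v,
      all (all (fun a => a < n)) T,
      all (fun r => nilp r || hook_word r) T &
      sorted (fun r r' => max_hook (r' ++ r) (size r)) T].

Definition SDT (n : nat) (lam : LambdaNeg n) := {T | is_SDT (val lam) T}.

Definition rd (T : seq (seq nat)) : seq nat := flatten (map rev T).

(* the filling of shape sh with reading word w *)
Definition unrd (sh : seq nat) (w : seq nat) : seq (seq nat) :=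
  map rev (reshape sh w).

(* A box is designated by its position p in the reading word. *)
Definition change (T : seq (seq nat)) (p : nat) (a : nat) : seq (seq nat) :=
  unrd (shape T) (set_nth 0 (rd T) p a).

(* One step of the left-to-right removal of the pairs (i+1, i); acc is the
   reversed list of the remaining positions. *)
Definition cancel_step (w : seq nat) (i : nat) (acc : seq nat) (p : nat) : seq nat :=
  if acc is q :: acc' then
    if (nth 0 w q == i.+1) && (nth 0 w p == i) then acc' else p :: acc
  else [:: p].

(* the positions, in w, of the letters i and i + 1 of w *)
Definition pos_i (w : seq nat) (i : nat) : seq nat :=
  [seq p <- iota 0 (size w) | (nth 0 w p == i) || (nth 0 w p == i.+1)].

(* the positions of the letters of w that remain in the word \overline{rd}_i *)
Definition rdbar (w : seq nat) (i : nat) : seq nat :=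
  rev (foldl (cancel_step w i) [::] (pos_i w i)).

Definition unmatched (w : seq nat) (i a : nat) : seq nat :=
  [seq p <- rdbar w i | nth 0 w p == a].

Definition raw_e (i : nat) (T : seq (seq nat)) : option (seq (seq nat)) :=
  if unmatched (rd T) i i.+1 is p :: _ then Some (change T p i) else None.

Definition raw_f (i : nat) (T : seq (seq nat)) : option (seq (seq nat)) :=
  if unmatched (rd T) i i is p :: s then Some (change T (last p s) i.+1) else None.

Definition raw_ebar (T : seq (seq nat)) : option (seq (seq nat)) :=
  if pos_i (rd T) 0 is p :: _ then
    if nth 0 (rd T) p == 1 then Some (change T p 0) else None
  else None.

Definition raw_fbar (T : seq (seq nat)) : option (seq (seq nat)) :=
  if pos_i (rd T) 0 is p :: _ then
    if nth 0 (rd T) p == 0 then Some (change T p 1) else None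
  else None.

Definition raw_op (n : nat) (rop : nat -> seq (seq nat) -> option (seq (seq nat)))
    (rbar : seq (seq nat) -> option (seq (seq nat))) (i : option 'I_n.-1)
    (T : seq (seq nat)) : option (seq (seq nat)) :=
  if i is Some k then rop k T else rbar T.

Lemma hook_wordP (w : seq nat) :
  reflect (exists D U, [/\ w = D ++ U, D <> [::], pairwise geq D &
             path ltn (last 0 D) U])
          (hook_word w).
Proof.
have geq_tr : transitive geq by move=> a b c /= h1 h2; exact: leq_trans h2 h1.
apply: (iffP existsP) => [[k /andP[h1 h2]]|[D [U [-> Dn sD pU]]]].
- exists (take k.+1 w), (drop k.+1 w); split.
  + by rewrite cat_take_drop.
  + by move/(congr1 size); rewrite size_take; case: w k {h1 h2} => [[]|a w k] //=; case: ifP.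
  + by rewrite -sorted_pairwise.
  + move: h2; rewrite (drop_nth 0 (ltn_ord k)) (take_nth 0 (ltn_ord k)) last_rcons.
    by [].
- have kP : (size D).-1 < size (D ++ U).
    by rewrite size_cat; case: (D) Dn => //= a s _; rewrite addSn ltnS leq_addr.
  exists (Ordinal kP) => /=.
  case/lastP: D Dn sD pU {kP} => // D d _ sD pU.
  rewrite size_rcons /= take_size_cat ?size_rcons // cat_rcons drop_size_cat //.
  by rewrite sorted_pairwise // sD /=; move: pU; rewrite last_rcons.
Qed.

Lemma max_hookP (w : seq nat) (m : nat) :
  reflect (forall u, subseq u w -> hook_word u -> size u <= m) (max_hook w m).
Proof.
apply: (iffP forallP) => [h u /subseqP[s /eqP ss ->] hu|h s].
- by have /implyP/(_ hu) := h (Tuple ss).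
- by apply/implyP => hs; apply: h => //; apply: mask_subseq.
Qed.

Lemma subseq_catP (T : eqType) (s1 s2 x : seq T) : subseq (s1 ++ s2) x ->
  exists x1 x2, [/\ x = x1 ++ x2, subseq s1 x1 & subseq s2 x2].
Proof.
elim: x s1 => [|a x IH] [|b s1] //=.
- by move=> /eqP ->; exists [::], [::].
- by move=> h; exists [::], (a :: x); split => //=; case: s2 h.
- case: eqP => [->|ne] h.
  + have [x1 [x2 [-> h1 h2]]] := IH _ h.
    by exists (a :: x1), x2; split => //=; rewrite eqxx.
  + have [x1 [x2 [-> h1 h2]]] := IH (b :: s1) h.
    by exists (a :: x1), x2; split => //=; case: eqP.
Qed.

Lemma subseq_consP (T : eqType) (a : T) (s x : seq T) : subseq (a :: s) x ->
  exists x1 x2, x = x1 ++ a :: x2 /\ subseq s x2.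
Proof.
elim: x => [|b x IH] //=; case: eqP => [-> h|_ /IH[x1 [x2 [-> h]]]].
- by exists [::], x.
- by exists (b :: x1), x2.
Qed.

Lemma subseq_nseq (a m : nat) (s : seq nat) :
  subseq (nseq m a) s = (m <= count_mem a s).
Proof.
apply/idP/idP => [h|].
  have := leq_count_subseq (pred1 a) h.
  by rewrite count_nseq /= eqxx mul1n.
elim: s m => [|b s IH] [|m] //=; rewrite ?sub0seq //.
rewrite [a == b]eq_sym; case: eqP => [_|_] /=; first by rewrite add1n ltnS; apply: IH.
by rewrite add0n => /IH.
Qed.

Lemma subseq_cat3 (T : eqType) (u x y : seq T) (a : T) :
  subseq u (x ++ a :: y) ->
  subseq u (x ++ y) \/
  exists u1 u2, [/\ u = u1 ++ a :: u2, subseq u1 x & subseq u2 y].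
Proof.
elim: x u => [|b x IH] u /=.
- case: u => [|c u]; first by rewrite sub0seq; left.
  rewrite /=; case: eqP => [->|_] h; last by left.
  by right; exists [::], u.
- case: u => [|c u]; first by left.
  case: eqP => [-> /IH[]|ne /IH[]].
  + by left.
  + by move=> [u1 [u2 [-> h1 h2]]]; right; exists (b :: u1), u2; rewrite /= eqxx.
  + by left.
  + move=> [u1 [u2 [-> h1 h2]]]; right; exists u1, u2; split => //.
    exact: subseq_trans h1 (subseq_cons _ _).
Qed.

Definition hook_le (w w' : seq nat) : Prop :=
  forall u, subseq u w -> hook_word u ->
  exists u', [/\ subseq u' w', hook_word u' & size u <= size u'].

Definition suf_le (a b : nat) (x : seq nat) : Prop :=
  forall x1 x2, x = x1 ++ x2 -> count_mem a x2 <= count_mem b x2.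
Definition pre_le (a b : nat) (y : seq nat) : Prop :=
  forall y1 y2, y = y1 ++ y2 -> count_mem a y1 <= count_mem b y1.

Lemma hook_le_change x y c c' :
  (forall D U1 u2, subseq (D ++ U1) x -> subseq u2 y -> D <> [::] ->
     pairwise geq D -> path ltn (last 0 D) (U1 ++ c :: u2) ->
     exists u', [/\ subseq u' (x ++ c' :: y), hook_word u' &
       size (D ++ U1 ++ c :: u2) <= size u']) ->
  (forall u1 D2 U, subseq u1 x -> subseq (D2 ++ U) y ->
     pairwise geq (u1 ++ c :: D2) -> path ltn (last c D2) U ->
     exists u', [/\ subseq u' (x ++ c' :: y), hook_word u' &
       size (u1 ++ c :: D2 ++ U) <= size u']) ->
  hook_le (x ++ c :: y) (x ++ c' :: y).
Proof.
move=> HU HD u /subseq_cat3[su|[u1 [u2 [-> s1 s2]]]] hu.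
  exists u; split => //; apply: subseq_trans su _.
  by rewrite subseq_cat2l subseq_cons.
have /hook_wordP[D [U [eDU Dn sD pU]]] := hu.
have [lt|ge] := leqP (size D) (size u1).
- have e1 : u1 = D ++ drop (size D) u1.
    rewrite -[LHS](cat_take_drop (size D)); congr (_ ++ _).
    have := congr1 (take (size D)) eDU.
    by rewrite [in RHS]take_size_cat // takel_cat // ltnW.
  have eU : U = drop (size D) u1 ++ c :: u2.
    have := congr1 (drop (size D)) eDU.
    by rewrite drop_size_cat // {1}e1 -catA drop_size_cat.
  rewrite e1 -catA; apply: HU => //; rewrite -?e1 -?eU //.
- have [D2 eD] : exists D2, D = u1 ++ c :: D2.
    exists (take (size D - (size u1).+1) u2).
    have := congr1 (take (size D)) eDU; rewrite [in RHS]take_size_cat // => {1}<-.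
    by rewrite take_cat ltnNge (ltnW ge) /= -[size D - size u1]subnSK.
  have eu2 : u2 = D2 ++ U.
    have := congr1 (drop (size (rcons u1 c))) eDU.
    by rewrite eD -catA /= -!cat_rcons !drop_size_cat.
  rewrite eu2; apply: HD => //; rewrite -?eu2 -?eD //.
  by move: pU; rewrite eD last_cat.
Qed.

Lemma hookI D U : D <> [::] -> pairwise geq D -> path ltn (last 0 D) U ->
  hook_word (D ++ U).
Proof. by move=> *; apply/hook_wordP; exists D, U. Qed.

Lemma subseq_rconsP (T : eqType) (a : T) (s x : seq T) : subseq (rcons s a) x ->
  exists x1 x2, x = x1 ++ a :: x2 /\ subseq s x1.
Proof.
rewrite -cats1 => /subseq_catP[x1 [x2 [-> s1 /subseq_consP[x3 [x4 [-> _]]]]]].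
exists (x1 ++ x3), x4; rewrite catA; split => //.
exact: subseq_trans s1 (prefix_subseq _ _).
Qed.

Lemma pairwise_geq_cat3 u1 c D2 :
  pairwise geq (u1 ++ c :: D2) ->
  [/\ pairwise geq u1, pairwise geq D2, {in u1, forall a, c <= a},
      {in D2, forall a, a <= c} & {in u1 & D2, forall a b, b <= a}].
Proof.
rewrite pairwise_cat /= => /and3P[/allrelP h1 h2 /andP[/allP h3 h4]].
split => //.
- by move=> a ua; apply: h1 => //; rewrite mem_head.
- by move=> a b ua hb; apply: h1 => //; rewrite inE hb orbT.
Qed.

Lemma pairwise_geq_catI D E :
  pairwise geq D -> pairwise geq E -> {in D & E, forall a b, b <= a} ->
  pairwise geq (D ++ E).
Proof. by move=> h1 h2 h; rewrite pairwise_cat h1 h2 !andbT; apply/allrelP => a b; apply: h. Qed.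

Lemma pairwise_geq_nseq m a : pairwise geq (nseq m a).
Proof. by elim: m => //= m ->; rewrite andbT all_nseq /= leqnn orbT. Qed.

(* a decreasing word bounded below by a ends with its occurrences of a *)
Lemma geq_split_low a D : pairwise geq D -> {in D, forall b, a <= b} ->
  D = [seq b <- D | a < b] ++ nseq (count_mem a D) a.
Proof.
elim: D => //= b D IH /andP[/allP h1 h2] h3.
have h4 : {in D, forall b, a <= b} by move=> d hd; apply: h3; rewrite inE hd orbT.
have := h3 b (mem_head _ _); rewrite leq_eqVlt => /orP[/eqP eab|lt].
- rewrite -eab ltnn eqxx add1n /=.
  have allD : all (pred1 a) D.
    apply/allP => d hd; have /= := h1 _ hd; rewrite -eab => le.
    by rewrite /= eqn_leq le h4.
  have -> : [seq b0 <- D | a < b0] = [::].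
    by apply/eqP; rewrite -[_ == _]negbK -has_filter; apply/hasPn => d /(allP allD)/eqP ->; rewrite ltnn.
  have /all_pred1P eD := allD.
  by rewrite /=; congr (_ :: _); rewrite {1}eD; congr nseq; apply/eqP; rewrite eq_sym -all_count.
- by rewrite lt gtn_eqF //= add0n -IH.
Qed.

(* a decreasing word bounded above by a starts with its occurrences of a *)
Lemma geq_split_high a D : pairwise geq D -> {in D, forall b, b <= a} ->
  D = nseq (count_mem a D) a ++ [seq b <- D | b < a].
Proof.
elim: D => //= b D IH /andP[/allP h1 h2] h3.
have h4 : {in D, forall b, b <= a} by move=> d hd; apply: h3; rewrite inE hd orbT.
have := h3 b (mem_head _ _); rewrite leq_eqVlt => /orP[/eqP eab|lt].
- by rewrite eab eqxx ltnn /= -IH.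
- have lta : forall d, d \in D -> d < a by move=> d hd; apply: leq_ltn_trans lt; apply: (h1 d hd).
  rewrite lt ltn_eqF //= add0n.
  have -> : count_mem a D = 0.
    by apply/count_memPn; apply/negP => /lta; rewrite ltnn.
  by congr (_ :: _); apply/esym/all_filterP/allP.
Qed.

Lemma hook_le_f i x y :
  suf_le i i.+1 x -> pre_le i.+1 i y -> hook_le (x ++ i :: y) (x ++ i.+1 :: y).
Proof.
move=> hx hy; apply: hook_le_change.
- move=> D U1 u2 sx sy Dn sD pU.
  case: (boolP (head 0 u2 == i.+1)) => [hd|nhd].
  + case: u2 hd sy pU => [|b u3] //= /eqP -> sy pU.
    have [y1 [y2 [ey sy2]]] := subseq_consP sy.
    have iy : i \in y1.
      have := hy (rcons y1 i.+1) y2; rewrite cat_rcons => /(_ ey).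
      rewrite -cats1 !count_cat /= eqxx (gtn_eqF (ltnSn i)) addn1 !addn0 => h.
      rewrite -has_pred1 has_count. exact: leq_trans (ltn0Sn _) h.
    exists (D ++ U1 ++ i :: i.+1 :: u3); split => //; last exact: hookI.
    rewrite catA; apply: cat_subseq => //; apply: subseq_trans (subseq_cons _ _).
    rewrite ey -cat1s; apply: cat_subseq; first by rewrite sub1seq.
    by rewrite /= eqxx.
  + exists (D ++ U1 ++ i.+1 :: u2); split.
    * by rewrite catA; apply: cat_subseq => //=; rewrite eqxx.
    * apply: hookI => //; move: pU; rewrite !cat_path /=.
      case: u2 nhd {sy} => [|b u2] /= nb /andP[-> /=].
        by rewrite !andbT => h; apply: ltnW.
      case/and3P => h1 h2 ->; rewrite andbT; apply/andP; split; first exact: ltnW.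
      by rewrite ltn_neqAle eq_sym nb.
    * by rewrite !size_cat.
- move=> u1 D2 U sx sy sD pU.
  have [s1 s2 l1 l2 l12] := pairwise_geq_cat3 sD.
  pose A := [seq b <- u1 | i < b]; pose d := count_mem i u1.
  have eu : u1 = A ++ nseq d i := geq_split_low s1 l1.
  have sA : pairwise geq A by move: s1; rewrite eu pairwise_cat => /and3P[].
  have lA : {in A, forall b, i < b} by move=> b; rewrite mem_filter => /andP[].
  have sx' : subseq (A ++ nseq d i.+1) x.
    move: sx; rewrite eu => /subseq_catP[x1 [x2 [ex h1 h2]]].
    rewrite ex; apply: cat_subseq => //; rewrite subseq_nseq.
    by apply: leq_trans (hx _ _ ex); rewrite -subseq_nseq.
  have sz : size (A ++ nseq d i.+1) = size u1.
    by rewrite [in RHS]eu !size_cat !size_nseq.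
  case: (boolP ((D2 == [::]) && (head 0 U == i.+1))) => [/andP[/eqP eD hd]|nhd].
  + case: U hd pU sy; rewrite eD //= => b U /eqP -> /andP[_ pU] sy.
    exists ((A ++ nseq d i.+1) ++ i.+1 :: i.+1 :: U); split.
    * by apply: cat_subseq => //=; rewrite eqxx.
    * rewrite -[_ :: _ :: U]/(nseq 2 i.+1 ++ U) catA; apply: hookI.
      - by move/(congr1 size); rewrite size_cat /= addnC.
      - rewrite -catA -nseqD; apply: pairwise_geq_catI => //.
          exact: pairwise_geq_nseq.
        by move=> a c /lA ia /nseqP[-> _].
      - by rewrite last_cat.
    * by rewrite size_cat [in leqRHS]size_cat sz.
  + exists ((A ++ nseq d i.+1) ++ i.+1 :: D2 ++ U); split.
    * by apply: cat_subseq => //=; rewrite eqxx.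
    * rewrite -cat_cons catA; apply: hookI.
      - by move/(congr1 size); rewrite size_cat /= addnC.
      - rewrite -catA -cat_rcons -cats1 -[[:: i.+1]]/(nseq 1 i.+1) -nseqD.
        apply: pairwise_geq_catI => //.
           apply: pairwise_geq_catI => //.
            exact: pairwise_geq_nseq.
          by move=> a b /nseqP[-> _] /l2 /leq_trans; apply.
        move=> a b /lA ia; rewrite mem_cat.
        case/orP=> [/nseqP[-> _] //|/l2 h]; exact: leq_trans h (ltnW ia).
      - rewrite last_cat /=; move: nhd pU {sy sD}; case: D2 {s2 l2 l12} => //=.
        case: U => //= b U nb /andP[ib ->]; rewrite andbT.
        by rewrite ltn_neqAle eq_sym nb.
    * by rewrite size_cat [in leqRHS]size_cat sz.
Qed.

Lemma path_ltn_all a U : path ltn a U -> {in U, forall b, a < b}.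
Proof.
elim: U a => //= b U IH a /andP[ab /IH h] c; rewrite inE => /orP[/eqP -> //|/h].
exact: ltn_trans.
Qed.

Lemma path_ltn_weak a a' U : a' <= a -> path ltn a U -> path ltn a' U.
Proof. by case: U => //= b U le /andP[lt ->]; rewrite (leq_ltn_trans le lt). Qed.

Lemma hook_le_e i x y :
  suf_le i i.+1 x -> pre_le i.+1 i y -> hook_le (x ++ i.+1 :: y) (x ++ i :: y).
Proof.
move=> hx hy; apply: hook_le_change.
- move=> D U1 u2 sx sy Dn sD pU.
  have [ei|ni] := eqVneq (last 0 (D ++ U1)) i.
  + have sx' : subseq (rcons (D ++ U1) i.+1) x.
      have nD : D ++ U1 <> [::] by case: (D) Dn.
      move: sx ei nD; case/lastP: (D ++ U1) => // s a sx.
      rewrite last_rcons => ea _; rewrite ea in sx *.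
      have [x1 [x2 [ex s1]]] := subseq_rconsP sx.
      have := hx x1 (i :: x2) ex; rewrite /= eqxx (ltn_eqF (ltnSn i)) add0n add1n => h.
      have ix : i.+1 \in x2 by rewrite -has_pred1 has_count; exact: leq_trans (ltn0Sn _) h.
      rewrite -2!cats1 -catA ex; apply: cat_subseq => //=.
      by rewrite eqxx sub1seq.
    exists (D ++ U1 ++ i.+1 :: u2); split => //; last exact: hookI.
    rewrite catA -(cat_rcons i.+1 (D ++ U1)); apply: cat_subseq => //.
    exact: subseq_trans sy (subseq_cons _ _).
  + exists (D ++ U1 ++ i :: u2); split.
    * by rewrite catA; apply: cat_subseq => //=; rewrite eqxx.
    * apply: hookI => //; move: pU; rewrite !cat_path /= => /and3P[-> h1 h2].
      rewrite (path_ltn_weak (leqnSn i) h2) andbT /=.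
      by rewrite last_cat in ni; rewrite ltn_neqAle ni -ltnS.
    * by rewrite !size_cat.
- move=> u1 D2 U sx sy sD pU.
  have [s1 s2 l1 l2 l12] := pairwise_geq_cat3 sD.
  pose B := [seq b <- D2 | b < i.+1]; pose d := count_mem i.+1 D2.
  have eD : D2 = nseq d i.+1 ++ B := geq_split_high s2 l2.
  have sB : pairwise geq B by move: s2; rewrite eD pairwise_cat => /and3P[].
  have lB : {in B, forall b, b <= i} by move=> b; rewrite mem_filter => /andP[].
  have sy' : subseq (nseq d i ++ B ++ U) y.
    move: sy; rewrite eD -catA => /subseq_catP[y1 [y2 [ey h1 h2]]].
    rewrite ey; apply: cat_subseq => //; rewrite subseq_nseq.
    by apply: leq_trans (hy _ _ ey); rewrite -subseq_nseq.
  exists (u1 ++ i :: nseq d i ++ B ++ U); split.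
  + by apply: cat_subseq => //=; rewrite eqxx.
  + rewrite -[i :: _ ++ _]/(nseq d.+1 i ++ B ++ U) !catA; apply: hookI.
    * by case: (u1).
    * rewrite -catA; apply: pairwise_geq_catI => //.
        apply: pairwise_geq_catI => //; first exact: pairwise_geq_nseq.
        by move=> a b /nseqP[-> _] /lB.
      move=> a b /l1 ia; rewrite mem_cat => /orP[/nseqP[-> _]|/lB h].
        exact: ltnW.
      exact: leq_trans h (ltnW ia).
    * move: pU; rewrite eD !last_cat; case: (B) => [|b B'] //=.
      have -> : last i.+1 (nseq d i.+1) = i.+1 by elim: (d).
      have -> : last i (nseq d i) = i by elim: (d).
      exact: path_ltn_weak.
  + by rewrite eD !size_cat /= !size_cat !size_nseq -!addnA.
Qed.

Definition low_free (y : seq nat) : Prop := {in y, forall b, 1 < b}.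

Lemma low_free_D2 (y D2 U : seq nat) c : low_free y -> subseq (D2 ++ U) y ->
  c <= 1 -> {in D2, forall b, b <= c} -> D2 = [::].
Proof.
case: D2 => // b D2 fy /mem_subseq/(_ b (mem_head _ _))/fy lb c1 /(_ b (mem_head _ _)) h.
by have := leq_ltn_trans (leq_trans h c1) lb; rewrite ltnn.
Qed.

Lemma hook_le_fbar x y : low_free y -> hook_le (x ++ 0 :: y) (x ++ 1 :: y).
Proof.
move=> fy; apply: hook_le_change.
  move=> D U1 u2 _ _ _ _; by rewrite cat_path /= andbF.
move=> u1 D2 U sx sy sD pU.
have [s1 s2 l1 l2 l12] := pairwise_geq_cat3 sD.
have eD := low_free_D2 fy sy (leq0n _) l2; subst D2.
exists (u1 ++ 1 :: U); split.
- by apply: cat_subseq => //=; rewrite eqxx.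
- have pU1 : path ltn 1 U.
    case: U pU sy => //= b U /andP[_ ->] /mem_subseq/(_ b (mem_head _ _))/fy ->.
    by [].
  case: (boolP ((u1 != [::]) && (last 0 u1 == 0))) => [/andP[/eqP n0 /eqP l0]|n0].
    by apply: hookI => //=; rewrite l0.
  rewrite -cat_rcons; apply: hookI; rewrite ?last_rcons //; first by case: (u1).
  rewrite -cats1; apply: pairwise_geq_catI => // a b ua; rewrite inE => /eqP ->.
  case/lastP: u1 n0 s1 ua {sx sD l1 l12} => // u1 d; rewrite last_rcons.
  have -> /= : rcons u1 d != [::] by case: (u1).
  rewrite -lt0n -cats1 pairwise_cat => d0 /and3P[/allrelP h _ _].
  rewrite mem_cat => /orP[ua|]; last by rewrite inE => /eqP ->.
  by apply: leq_trans d0 _; apply: h; rewrite ?mem_head.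
- by rewrite !size_cat.
Qed.

Lemma hook_le_ebar x y : low_free y -> hook_le (x ++ 1 :: y) (x ++ 0 :: y).
Proof.
move=> fy; apply: hook_le_change.
- move=> D U1 u2 sx sy Dn sD pU.
  have [eU l0] : U1 = [::] /\ last 0 D = 0.
    move: pU; rewrite cat_path /=; case: U1 {sx} => [|b U1] /=.
      by rewrite ltnS leqn0 => /andP[/eqP].
    case/andP=> /andP[lb hU] /andP[hl _]; exfalso.
    have : b <= last b U1.
      have /path_ltn_all h := hU; have := mem_last b U1.
      by rewrite inE => /orP[/eqP -> //|/h/ltnW].
    by move: hl; rewrite ltnS leqn0 => /eqP ->; case: (b) lb.
  subst U1; exists ((D ++ [:: 0]) ++ u2); split.
  + rewrite -catA; apply: cat_subseq => //=; by rewrite cats0 in sx.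
  + apply: hookI; first by case: (D).
      apply: pairwise_geq_catI => // a b _; rewrite inE => /eqP -> //.
    rewrite last_cat /=; move: pU => /=; rewrite l0 => /= h.
    by apply: path_ltn_weak h.
  + by rewrite -catA !size_cat.
- move=> u1 D2 U sx sy sD pU.
  have [s1 s2 l1 l2 l12] := pairwise_geq_cat3 sD.
  have eD := low_free_D2 fy sy (leqnn _) l2; subst D2.
  exists ((u1 ++ [:: 0]) ++ U); split.
  + by rewrite -catA; apply: cat_subseq.
  + apply: hookI; first by case: (u1).
      apply: pairwise_geq_catI => // a b _; rewrite inE => /eqP -> //.
    by rewrite last_cat /=; apply: path_ltn_weak pU.
  + by rewrite -catA !size_cat.
Qed.

Lemma hook_le_max w w' m : hook_le w' w -> max_hook w m -> max_hook w' m.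
Proof.
move=> le /max_hookP h; apply/max_hookP => u su hu.
have [u' [su' hu' lu]] := le u su hu; exact: leq_trans lu (h _ su' hu').
Qed.

Lemma hook_le_hook w w' :
  hook_le w w' -> size w = size w' -> hook_word w -> hook_word w'.
Proof.
move=> le sz hw; have [u [su hu lu]] := le w (subseq_refl w) hw.
have /eqP <- // : u == w'.
by rewrite -(size_subseq_leqif su) eqn_leq (size_subseq su) -sz lu.
Qed.

Lemma rd_cat T1 T2 : rd (T1 ++ T2) = rd T1 ++ rd T2.
Proof. by rewrite /rd map_cat flatten_cat. Qed.

Lemma rd_cons r T : rd (r :: T) = rev r ++ rd T.
Proof. by []. Qed.

Lemma unrdK T : unrd (shape T) (rd T) = T.
Proof.
rewrite /unrd /rd; have -> : shape T = shape (map rev T).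
  by rewrite /shape -map_comp; apply: eq_map => r /=; rewrite size_rev.
by rewrite flattenK -map_comp; apply: map_id_in => r _ /=; rewrite revK.
Qed.

Lemma set_nth_size_cat (s1 s2 : seq nat) c c' :
  set_nth 0 (s1 ++ c :: s2) (size s1) c' = s1 ++ c' :: s2.
Proof. by elim: s1 => //= a s1 ->. Qed.

Lemma changeE T1 r T2 a b c c' p : rev r = a ++ c :: b -> p = size (rd T1 ++ a) ->
  change (T1 ++ r :: T2) p c' = T1 ++ rev (a ++ c' :: b) :: T2.
Proof.
move=> er ->; rewrite /change -[RHS]unrdK; congr unrd.
- rewrite /shape !map_cat /=; congr (_ ++ _ :: _).
  by rewrite -size_rev er size_rev !size_cat.
- by rewrite !rd_cat !rd_cons er revK -!catA /= catA set_nth_size_cat -catA.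
Qed.

Lemma rd_split T p : p < size (rd T) ->
  exists T1 r T2 a b, [/\ T = T1 ++ r :: T2,
    rev r = a ++ nth 0 (rd T) p :: b, p = size (rd T1 ++ a),
    take p (rd T) = rd T1 ++ a & drop p.+1 (rd T) = b ++ rd T2].
Proof.
elim: T p => //= r T IH p; rewrite rd_cons.
rewrite size_cat size_rev => lt.
have [ltr|ge] := ltnP p (size r).
- exists [::], r, T, (take p (rev r)), (drop p.+1 (rev r)).
  have ltr' : p < size (rev r) by rewrite size_rev.
  rewrite nth_cat take_cat !(ifT _ _ ltr') -drop_nth // cat_take_drop /rd /= size_takel ?(ltnW ltr') //.
  split => //; rewrite drop_cat; have [//|ge] := ltnP p.+1 (size (rev r)).
  have -> : p.+1 = size (rev r) by apply/eqP; rewrite eqn_leq ltr' ge.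
  by rewrite subnn drop0 drop_size.
- have /IH[T1 [r' [T2 [a [b [eT er ep et ed]]]]]] : p - size r < size (rd T).
    by rewrite ltn_subLR.
  exists (r :: T1), r', T2, a, b; rewrite rd_cons nth_cat take_cat drop_cat.
  rewrite size_rev (ltnNge p) ge ltnNge (leqW ge) /= subSn //.
  split => //; first by rewrite eT.
  + by rewrite -catA size_cat size_rev -ep subnKC.
  + by rewrite et catA.
Qed.

Lemma change_SDT (P : seq nat -> seq nat -> Prop) n (v : 'rV[int]_n) T p c' :
  (forall Y1 Y X X1, P (Y1 ++ Y) (X ++ X1) -> P Y X) ->
  (forall Y X, P Y X -> let c := nth 0 (rd T) p in
    hook_le (rev (Y ++ c :: X)) (rev (Y ++ c' :: X)) /\
    hook_le (rev (Y ++ c' :: X)) (rev (Y ++ c :: X))) ->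
  c' < n -> p < size (rd T) -> P (take p (rd T)) (drop p.+1 (rd T)) ->
  is_SDT v T -> is_SDT v (change T p c').
Proof.
move=> Pcl Ph c'n /rd_split[T1 [r [T2 [a [b [eT er ep -> ->]]]]]] hP.
rewrite [in change _ _ _]eT (changeE T2 c' er ep).
move: er Ph; set c := nth 0 _ _ => er Ph.
set r' := rev (a ++ c' :: b).
have szr : size r' = size r by rewrite -(size_rev r) er size_rev !size_cat.
have er' : r = rev (a ++ c :: b) by rewrite -er revK.
rewrite /is_SDT eT => /and4P[h1 h2 h3 h4]; apply/and4P; split.
- by move: h1; rewrite /shape !map_cat /= szr.
- move: h2; rewrite !all_cat /= => /and3P[-> h ->]; rewrite andbT /=.
  move: h; rewrite er' /r' !all_rev !all_cat /= => /and3P[-> _ ->].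
  by rewrite c'n.
- move: h3; rewrite !all_cat /= => /and3P[-> h ->]; rewrite andbT /=.
  move: h; rewrite /nilp szr => /orP[->//|h]; apply/orP; right.
  apply: hook_le_hook (esym szr) h; rewrite er'; apply: (Ph _ _ _).1.
  exact: Pcl hP.
- move: h4; rewrite !sorted_cat_cons => /andP[s1 s2]; apply/andP; split.
  + case/lastP: T1 hP s1 {eT ep h1 h2 h3} => // T1 r0 hP.
    rewrite -!cats1 -!catA /= !sorted_cat_cons /= !andbT => /andP[-> mx] /=.
    apply: hook_le_max mx; rewrite er' /r' -[r0]revK -!rev_cat !catA.
    apply: (Ph _ _ _).2; move: hP; rewrite -cats1 rd_cat rd_cons cats0 -catA.
    exact: Pcl.
  + case: T2 hP s2 {eT h1 h2 h3} => //= r1 T2 hP /andP[mx ->]; rewrite andbT szr.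
    apply: hook_le_max mx; rewrite er' /r' -[r1]revK -!rev_cat -!catA /=.
    apply: (Ph _ _ _).2; move: hP; rewrite rd_cons catA.
    exact: Pcl.
Qed.

Section Reduced.
Variables (w : seq nat) (i : nat).
Notation L := (nth 0 w).
Notation red s := (rev (foldl (cancel_step w i) [::] s)).

Lemma red_rcons s p : red (rcons s p) =
  if (red s != [::]) && (L (last 0 (red s)) == i.+1) && (L p == i)
  then take (size (red s)).-1 (red s) else rcons (red s) p.
Proof.
rewrite foldl_rcons; case: (foldl _ _ _) => [|q acc] //=.
rewrite rev_cons last_rcons size_rcons /=.
have -> : rcons (rev acc) q != [::] by case: (rev acc).
case: ifP => //= _; first by rewrite -cats1 take_size_cat.
by rewrite -!rev_cons.
Qed.

(* every box left by the cancellation splits the word into two parts which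
   cancel independently *)
Lemma red_split s R1 z R2 : red s = R1 ++ z :: R2 ->
  exists s1 s2, [/\ s = s1 ++ z :: s2, red s1 = R1 & red s2 = R2].
Proof.
elim/last_ind: s R2 => [|s p IH] R2; first by case: R1.
rewrite red_rcons; case: ifP => [|nc].
- case/lastP E : (red s) => [|R q] //; rewrite last_rcons size_rcons /=.
  rewrite -cats1 take_size_cat // => /andP[/andP[_ lq] lp] eR.
  have [|s1 [s2 [es e1 e2]]] := IH (rcons R2 q).
    by rewrite E eR -!cats1 -catA.
  exists s1, (rcons s2 p); split => //; first by rewrite es rcons_cat.
  rewrite red_rcons e2 last_rcons size_rcons lq lp /= -cats1 take_size_cat //.
  by case: (R2).
- case/lastP: R2 => [|R2 q]; first rewrite -cat_rcons cats0.
    move=> /rcons_inj[<- <-].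
    by exists s, [::]; rewrite cats1.
  move=> eR; have [E eq] : red s = R1 ++ z :: R2 /\ p = q.
    by move: eR; rewrite -rcons_cons -rcons_cat => /rcons_inj[].
  have [s1 [s2 [es e1 e2]]] := IH _ E.
  exists s1, (rcons s2 p); split => //; first by rewrite es rcons_cat.
  rewrite red_rcons e2 eq; case: ifP => // /andP[/andP[n lq] lp].
  move: nc; rewrite E last_cat /= eq lp andbT.
  have -> : last z R2 = last 0 R2 by case: (R2) n.
  by rewrite lq andbT; case: (R1).
Qed.

Definition cnt a (s : seq nat) := count (fun q => L q == a) s.

Lemma cnt_hi s1 s2 :
  cnt i.+1 s2 <= cnt i.+1 (red (s1 ++ s2)) + cnt i s2.
Proof.
elim/last_ind: s2 => [|s2 p IH] //.
rewrite -rcons_cat red_rcons; case: ifP => [|_].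
- case/lastP E : (red (s1 ++ s2)) IH => [|R q] //.
  rewrite last_rcons size_rcons /= -cats1 take_size_cat // => IH.
  case/andP=> /andP[_ /eqP lq] /eqP lp; move: IH.
  rewrite -!cats1 /cnt !count_cat /= lq lp !eqxx (ltn_eqF (ltnSn i)) /=.
  by rewrite !addn0 addnAC -!addnA.
- rewrite -!cats1 /cnt !count_cat /= !addn0; move: IH; rewrite /cnt => IH.
  by rewrite addnACA; apply: leq_add IH (leq_addr _ _).
Qed.

Lemma cnt_eq s :
  cnt i s + cnt i.+1 (red s) = cnt i (red s) + cnt i.+1 s.
Proof.
elim/last_ind: s => [|s p IH] //.
rewrite red_rcons; case: ifP => [|_].
- case/lastP E : (red s) IH => [|R q] //.
  rewrite last_rcons size_rcons /= -cats1 take_size_cat // => IH.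
  case/andP=> /andP[_ /eqP lq] /eqP lp; move: IH.
  rewrite -!cats1 /cnt !count_cat /= lq lp !eqxx (ltn_eqF (ltnSn i)).
  rewrite (gtn_eqF (ltnSn i)) !addn0 => <-.
  by rewrite -addnA [true + _]addnC.
- rewrite -!cats1 /cnt !count_cat /= !addn0 addnACA; move: IH; rewrite /cnt => ->.
  by rewrite addnACA; congr (_ + _); rewrite addnC.
Qed.

Lemma cnt_mono s1 s2 : cnt i (red s1) <= cnt i (red (s1 ++ s2)).
Proof.
elim/last_ind: s2 => [|s p IH]; first by rewrite cats0.
rewrite -rcons_cat red_rcons; case: ifP => [|_].
- case/lastP E : (red (s1 ++ s)) IH => [|R q] //.
  rewrite last_rcons size_rcons /= -cats1 take_size_cat // => IH.
  case/andP=> /andP[_ /eqP lq] _; move: IH.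
  by rewrite /cnt count_cat /= lq (gtn_eqF (ltnSn i)) !addn0.
- by apply: leq_trans IH _; rewrite -cats1 /cnt count_cat leq_addr.
Qed.

Lemma cnt_lo s1 s2 : cnt i s1 <= cnt i (red (s1 ++ s2)) + cnt i.+1 s1.
Proof.
apply: leq_trans (leq_addr (cnt i.+1 (red s1)) _) _.
by rewrite cnt_eq leq_add2r cnt_mono.
Qed.

Definition low (s : seq nat) := all (fun q => (L q == i) || (L q == i.+1)) s.

(* what is left is a word of i's followed by a word of (i+1)'s *)
Lemma red_sorted s : low s -> exists A B,
  [/\ red s = A ++ B, all (fun q => L q == i) A & all (fun q => L q == i.+1) B].
Proof.
elim/last_ind: s => [|s p IH]; first by exists [::], [::].
rewrite /low all_rcons => /andP[lp /IH[A [B [E hA hB]]]].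
rewrite red_rcons E; case: ifP => [/andP[/andP[n lq] _]|nc].
- case/lastP: B hB n lq {E} => [|B q hB _ _].
    rewrite cats0; case/lastP: A hA => // A q; rewrite all_rcons last_rcons.
    by move=> /andP[/eqP ->] _ _; rewrite (ltn_eqF (ltnSn i)).
  exists A, B; split => //; last by move: hB; rewrite all_rcons => /andP[].
  by rewrite size_cat size_rcons addnS /= -rcons_cat -cats1 take_size_cat ?size_cat.
- case/orP: lp => lp; last first.
    by exists A, (rcons B p); rewrite rcons_cat all_rcons lp.
  exists (rcons A p), [::]; rewrite all_rcons lp hA cats0; split => //.
  case/lastP: B hB nc {E} => [|B q]; first by rewrite cats0.
  rewrite all_rcons last_cat last_rcons lp => /andP[-> _].
  by rewrite !andbT; case: (A) (B) => [|? ?] [].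
Qed.

End Reduced.

Lemma filter_split (T : Type) (P : pred T) (s s1 s2 : seq T) z :
  filter P s = s1 ++ z :: s2 ->
  exists t1 t2, [/\ s = t1 ++ z :: t2, filter P t1 = s1 & filter P t2 = s2].
Proof.
elim: s s1 => [|a s IH] s1 /=; first by case: s1.
case: ifP => Pa; last first.
  by move=> /IH[t1 [t2 [-> h1 h2]]]; exists (a :: t1), t2; rewrite /= Pa.
case: s1 => [|b s1] /=.
  by move=> [<- <-]; exists [::], s.
by move=> [<-] /IH[t1 [t2 [-> <- h2]]]; exists (a :: t1), t2; rewrite /= Pa.
Qed.

Lemma iota_split N t1 t2 z : iota 0 N = t1 ++ z :: t2 ->
  [/\ z < N, t1 = iota 0 z & t2 = iota z.+1 (N - z.+1)].
Proof.
move=> E; have sN : size t1 < N.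
  by rewrite -(size_iota 0 N) E size_cat /= addnS ltnS leq_addr.
have ez : z = size t1.
  by rewrite -[size t1]add0n -(nth_iota 0 0 sN) E nth_cat ltnn subnn.
subst z; split => //.
- have := congr1 (take (size t1)) E; rewrite [in RHS]take_size_cat // => e; rewrite -[LHS]e.
  by rewrite take_iota (minn_idPl (ltnW sN)).
- have := congr1 (drop (size t1).+1) E.
  rewrite -cat_rcons [in RHS]drop_size_cat ?size_rcons // => e.
  by rewrite -[LHS]e drop_iota.
Qed.

(* A box marked by the signature rule for i cuts the reading word into such
   x and y. *)
Definition marked (i : nat) (x y : seq nat) : Prop :=
  suf_le i.+1 i x /\ pre_le i i.+1 y.

Lemma cnt_pos_i (w : seq nat) i a (t : seq nat) : (a == i) || (a == i.+1) ->
  cnt w a [seq p <- t | (nth 0 w p == i) || (nth 0 w p == i.+1)]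
  = count_mem a (map (nth 0 w) t).
Proof.
move=> ha; rewrite /cnt count_filter count_map; apply: eq_count => q /=.
by case: eqP => //= ->; rewrite ha.
Qed.

Lemma rdbar_marked w i R1 z R2 : rdbar w i = R1 ++ z :: R2 ->
  all (fun q => nth 0 w q == i) R1 -> all (fun q => nth 0 w q == i.+1) R2 ->
  z < size w /\ marked i (take z w) (drop z.+1 w).
Proof.
move=> E h1 h2; have [s1 [s2 [es r1 r2]]] := red_split E.
have [t1 [t2 [et e1 e2]]] := filter_split es.
have [zN ez1 ez2] := iota_split et.
have tz : take z w = map (nth 0 w) t1.
  by rewrite ez1 map_nth_iota0 // ltnW.
have dz : drop z.+1 w = map (nth 0 w) t2.
  by rewrite ez2 map_nth_iota ?take_oversize ?size_drop // subnKC.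
split=> //; split.
- rewrite tz => x1 x2 ex.
  have [u1 [u2 [eu _ ->]]] : exists u1 u2, [/\ t1 = u1 ++ u2,
      x1 = map (nth 0 w) u1 & x2 = map (nth 0 w) u2].
    exists (take (size x1) t1), (drop (size x1) t1).
    by rewrite cat_take_drop map_take map_drop ex take_size_cat ?drop_size_cat.
  rewrite -(@cnt_pos_i w i i.+1) ?eqxx ?orbT // -(@cnt_pos_i w i i) ?eqxx //.
  have := cnt_hi w i (filter (fun p => (nth 0 w p == i) || (nth 0 w p == i.+1)) u1)
                     (filter (fun p => (nth 0 w p == i) || (nth 0 w p == i.+1)) u2).
  rewrite -filter_cat -eu e1 r1.
  suff -> : cnt w i.+1 R1 = 0 by [].
  apply/eqP; rewrite -leqn0 leqNgt -has_count; apply/hasPn => q /(allP h1) /eqP ->.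
  by rewrite ltn_eqF.
- rewrite dz => y1 y2 ey.
  have [u1 [u2 [eu -> _]]] : exists u1 u2, [/\ t2 = u1 ++ u2,
      y1 = map (nth 0 w) u1 & y2 = map (nth 0 w) u2].
    exists (take (size y1) t2), (drop (size y1) t2).
    by rewrite cat_take_drop map_take map_drop ey take_size_cat ?drop_size_cat.
  rewrite -(@cnt_pos_i w i i) ?eqxx // -(@cnt_pos_i w i i.+1) ?eqxx ?orbT //.
  have := cnt_lo w i (filter (fun p => (nth 0 w p == i) || (nth 0 w p == i.+1)) u1)
                     (filter (fun p => (nth 0 w p == i) || (nth 0 w p == i.+1)) u2).
  rewrite -filter_cat -eu e2 r2.
  suff -> : cnt w i R2 = 0 by [].
  apply/eqP; rewrite -leqn0 leqNgt -has_count; apply/hasPn => q /(allP h2) /eqP ->.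
  by rewrite gtn_eqF.
Qed.

Lemma rdbar_form w i : exists A B, [/\ rdbar w i = A ++ B,
  all (fun q => nth 0 w q == i) A & all (fun q => nth 0 w q == i.+1) B].
Proof. by apply: red_sorted; apply: filter_all. Qed.

Lemma unmatched_form w i : rdbar w i = unmatched w i i ++ unmatched w i i.+1.
Proof.
have [A [B [E hA hB]]] := rdbar_form w i.
rewrite /unmatched E !filter_cat.
have -> : [seq p <- A | nth 0 w p == i] = A by apply/all_filterP.
have -> : [seq p <- B | nth 0 w p == i.+1] = B by apply/all_filterP.
have -> : [seq p <- B | nth 0 w p == i] = [::].
  apply/eqP; rewrite -[_ == _]negbK -has_filter; apply/hasPn => q /(allP hB) /eqP ->.
  by rewrite gtn_eqF.
have -> : [seq p <- A | nth 0 w p == i.+1] = [::].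
  apply/eqP; rewrite -[_ == _]negbK -has_filter; apply/hasPn => q /(allP hA) /eqP ->.
  by rewrite ltn_eqF.
by rewrite cats0.
Qed.

Lemma marked_sub i Y1 Y X X1 : marked i (Y1 ++ Y) (X ++ X1) -> marked i Y X.
Proof.
move=> [hY hX]; split=> [x1 x2 e|y1 y2 e].
- by apply: (hY (Y1 ++ x1)); rewrite e catA.
- by apply: (hX _ (y2 ++ X1)); rewrite e catA.
Qed.

Lemma marked_rev i Y X : marked i Y X ->
  suf_le i i.+1 (rev X) /\ pre_le i.+1 i (rev Y).
Proof.
move=> [hY hX]; split=> [x1 x2 e|y1 y2 e].
- rewrite -!(count_rev _ x2); apply: (hX _ (rev x1)).
  by rewrite -rev_cat -e revK.
- rewrite -!(count_rev _ y1); apply: (hY (rev y2)).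
  by rewrite -rev_cat -e revK.
Qed.

Lemma rev_mid (Y X : seq nat) c : rev (Y ++ c :: X) = rev X ++ c :: rev Y.
Proof. by rewrite rev_cat rev_cons cat_rcons. Qed.

Lemma marked_hook i Y X : marked i Y X ->
  hook_le (rev (Y ++ i :: X)) (rev (Y ++ i.+1 :: X)) /\
  hook_le (rev (Y ++ i.+1 :: X)) (rev (Y ++ i :: X)).
Proof.
move=> /marked_rev[h1 h2]; rewrite !rev_mid.
by split; [apply: hook_le_f | apply: hook_le_e].
Qed.

Lemma unmatched_nth w i a p : p \in unmatched w i a -> nth 0 w p = a.
Proof. by rewrite mem_filter => /andP[/eqP]. Qed.

Lemma all_unmatched w i a : all (fun q => nth 0 w q == a) (unmatched w i a).
Proof. exact: filter_all. Qed.

Lemma raw_e_SDT n (v : 'rV[int]_n) i T T' : i.+1 < n -> is_SDT v T ->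
  raw_e i T = Some T' -> is_SDT v T'.
Proof.
rewrite /raw_e => lin hT; case E : (unmatched _ _ _) => [|p s] // [<-].
have np : nth 0 (rd T) p = i.+1.
  by apply: (@unmatched_nth _ i); rewrite E mem_head.
have [|||pw hm] := @rdbar_marked (rd T) i (unmatched (rd T) i i) p s.
- by rewrite -E unmatched_form.
- exact: all_unmatched.
- by have := all_unmatched (rd T) i i.+1; rewrite E => /andP[].
apply: (change_SDT (P := marked i)) hT => //.
- exact: marked_sub.
- by move=> Y X /marked_hook[h1 h2] c; rewrite /c np.
- exact: ltnW.
Qed.

Lemma raw_f_SDT n (v : 'rV[int]_n) i T T' : i.+1 < n -> is_SDT v T ->
  raw_f i T = Some T' -> is_SDT v T'.
Proof.
rewrite /raw_f => lin hT; case E : (unmatched _ _ _) => [|p0 s] // [<-].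
move: E; rewrite lastI; move: (belast _ _) (last _ _) => s1 p E {p0 s}.
have np : nth 0 (rd T) p = i.
  by apply: (@unmatched_nth _ i); rewrite E mem_rcons mem_head.
have [|||pw hm] := @rdbar_marked (rd T) i s1 p (unmatched (rd T) i i.+1).
- by rewrite unmatched_form E cat_rcons.
- by have := all_unmatched (rd T) i i; rewrite E all_rcons => /andP[].
- exact: all_unmatched.
apply: (change_SDT (P := marked i)) hT => //.
- exact: marked_sub.
- by move=> Y X /marked_hook[h1 h2] c; rewrite /c np.
Qed.

Lemma pos0_split w p s : pos_i w 0 = p :: s ->
  p < size w /\ low_free (take p w).
Proof.
move=> E; have [t1 [t2 [et e1 _]]] := @filter_split _ _ _ [::] _ _ E.
have [pN ez1 _] := iota_split et; split=> // b.
have -> : take p w = map (nth 0 w) t1 by rewrite ez1 map_nth_iota0 // ltnW.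
case/mapP=> q qt ->; move: e1 => /eqP; rewrite -[_ == _]negbK -has_filter.
by move=> /hasPn/(_ q qt); case: (nth 0 w q) => [|[]].
Qed.

Lemma low_free_sub (Y1 Y X X1 : seq nat) : low_free (Y1 ++ Y) -> low_free Y.
Proof. by move=> h b hb; apply: h; rewrite mem_cat hb orbT. Qed.

Lemma low_free_rev Y : low_free Y -> low_free (rev Y).
Proof. by move=> h b; rewrite mem_rev; apply: h. Qed.

Lemma raw_ebar_SDT n (v : 'rV[int]_n) T T' : 1 < n -> is_SDT v T ->
  raw_ebar T = Some T' -> is_SDT v T'.
Proof.
rewrite /raw_ebar => ln hT; case E : (pos_i _ _) => [|p s] //.
case: eqP => // np [<-]; have [pw hm] := pos0_split E.
apply: (change_SDT (P := fun Y _ => low_free Y)) hT => //.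
- exact: low_free_sub.
- move=> Y X /low_free_rev h c; rewrite /c np !rev_mid.
  by split; [apply: hook_le_ebar | apply: hook_le_fbar].
- exact: ltnW.
Qed.

Lemma raw_fbar_SDT n (v : 'rV[int]_n) T T' : 1 < n -> is_SDT v T ->
  raw_fbar T = Some T' -> is_SDT v T'.
Proof.
rewrite /raw_fbar => ln hT; case E : (pos_i _ _) => [|p s] //.
case: eqP => // np [<-]; have [pw hm] := pos0_split E.
apply: (change_SDT (P := fun Y _ => low_free Y)) hT => //.
- exact: low_free_sub.
- move=> Y X /low_free_rev h c; rewrite /c np !rev_mid.
  by split; [apply: hook_le_fbar | apply: hook_le_ebar].
Qed.

Section SDTCrystal.
Variables (n : nat) (lam : LambdaNeg n).

(* For n >= 2, insub never fails here: see sdt_eE and sdt_fE. *)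
Definition sdt_e (i : option 'I_n.-1) (T : SDT lam) : option (SDT lam) :=
  obind insub (raw_op raw_e raw_ebar i (val T)).

Definition sdt_f (i : option 'I_n.-1) (T : SDT lam) : option (SDT lam) :=
  obind insub (raw_op raw_f raw_fbar i (val T)).

Lemma sdt_eE (i : option 'I_n.-1) (T : SDT lam) : 1 < n ->
  omap val (sdt_e i T) = raw_op raw_e raw_ebar i (val T).
Proof.
rewrite /sdt_e => n1; case E : (raw_op _ _ i _) => [T'|] //=.
rewrite insubT //=; case: i E => [k|] /=.
- exact: raw_e_SDT (ihi_subproof k) (valP T).
- exact: raw_ebar_SDT n1 (valP T).
Qed.

Lemma sdt_fE (i : option 'I_n.-1) (T : SDT lam) : 1 < n ->
  omap val (sdt_f i T) = raw_op raw_f raw_fbar i (val T).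
Proof.
rewrite /sdt_f => n1; case E : (raw_op _ _ i _) => [T'|] //=.
rewrite insubT //=; case: i E => [k|] /=.
- exact: raw_f_SDT (ihi_subproof k) (valP T).
- exact: raw_fbar_SDT n1 (valP T).
Qed.

Definition SDTcrystal : crystal n :=
  Crystal sdt_e sdt_f
    (fun i T => Some (Posz (size (unmatched (rd (val T)) i i.+1))))
    (fun i T => Some (Posz (size (unmatched (rd (val T)) i i))))
    (fun T => (\row_j Posz (count_mem (j : nat) (rd (val T))))%R).

(* The weight of t is minus that of the tableau described at w0_parts, whose
   image in SDT_T has therefore weight 0. *)
Definition SDT_T : crystal n :=
  tensor SDTcrystal (Tcrystal (- w0_parts lam)%R).

End SDTCrystal.

(* E(T), for T with n rows: mu_(k+1) letters n - k (in the usual alphabet) are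
   added on the left of the row k + 1. *)
Definition add_boxes (n : nat) (mu : 'rV[int]_n) (T : seq (seq nat)) : seq (seq nat) :=
  mkseq (fun k => nseq (nth 0 (parts mu) k) (n - k.+1) ++ nth [::] T k) n.

(* The map upsilon_(lam, lam + mu), indexed by lam and kap = lam + mu rather
   than by lam and mu. *)
Definition upsilon (n : nat) (lam kap : LambdaNeg n) (_ : lambda_le lam kap)
    (x : SDT_T lam) : option (SDT_T kap) :=
  omap (fun T' : SDT kap => (T', tt))
    (insub (add_boxes (val kap - val lam)%R (val x.1))).

(* Main.v *)
Require Import Defs.
From mathcomp Require Import all_boot all_order all_algebra.
From mathcomp Require Import zify.

(** Why the theorem holds.

    Three things have to be checked: LambdaNeg is directed, each SDT_T is an
    abstract queer crystal, and the maps upsilon are crystal embeddings that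
    compose. The first is immediate, since sums of elements of LambdaNeg are
    in LambdaNeg. The other two rest on one description of the operators.

    The signature of a word for i is the pair (a, b) such that the
    cancellation of the pairs (i+1, i) leaves a letters i followed by b
    letters i+1. It is multiplicative ([sig_cat]):
    (a, b)(a', b') = (a + (a' - b), b' + (b - a')) with truncated subtraction.
    Hence f_i turns the word x i y into x (i+1) y, and e_i turns x (i+1) y into
    x i y, under one and the same condition on (x, y): no i+1 survives in x and
    no i survives in y. For the queer operators the condition is that x has
    none of the two smallest letters. As the condition does not involve the
    box itself, e_i and f_i are mutually inverse; the changes of epsilon, phi
    and of the weight are read off from signatures; and operators that concern
    disjoint pairs of letters commute, because neither sees the boxes changed
    by the other ([raw_actP], [raw_act_inv], [raw_act_comm]).

    For the embeddings, the point is that the letters of a semistandard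
    decomposition tableau form a staircase. If a letter b of a row were at
    least the first letter of the row r above it, then b followed by r would be
    a hook subword longer than r. So every letter of a row is smaller than the
    first letter of the row above, and the row with k rows below it only has
    letters at most k ([staircase_of_rows], letters being counted from 0). The map
    upsilon adds letters k to that row. For given i, the added letters that matter
    are thus the letters i+1 of the row with i+1 rows below, and the letters i
    of the next row, which is the last one having letters i at all. Replacing
    the leading letters i+1 of the upper of these rows by the letters i of
    the lower one shows, by maximality again, that there are at least as many
    of the former as of the latter ([leading_high]); so all those letters i
    are cancelled. As upsilon adds at least as many letters i+1 to the upper
    row as letters i to the lower one, this remains true afterwards, and the
    signature only changes in its number of letters i+1. Therefore phi_i is
    preserved ([lows_pad]), and a box changed by an operator is read before these
    added letters and is still the one to be changed ([raw_act_pad]). The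
    shift by T_nu restores the weight, and with it epsilon_i.

    That the enlarged tableau is again semistandard uses strictness of the
    added partition: a hook subword meeting both the letters added below and
    those added above ends in a single added letter of the upper row
    ([max_hook_pad]). *)

(** * Signatures of words *)

(** The bracketing rule, read from the left: s.2 counts the pending letters
    i+1, which the next letters i cancel. *)
Definition sig_step (s : nat * nat) (t : bool * bool) : nat * nat :=
  if t.2 then (s.1, s.2.+1)
  else if t.1 then (s.1 + (s.2 == 0), s.2.-1) else s.

(** All that the rule for i sees of a letter; two words with the same codes
    behave alike. *)
Definition code (i c : nat) : bool * bool := (c == i, c == i.+1).

Definition sig (i : nat) (w : seq nat) : nat * nat :=
  foldl sig_step (0, 0) (map (code i) w).

(* the numbers of letters i and i+1 that survive the cancellation *)
Notation lows i w := (sig i w).1.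
Notation highs i w := (sig i w).2.

Lemma sig_rcons i w c : sig i (rcons w c) = sig_step (sig i w) (code i c).
Proof. by rewrite /sig map_rcons foldl_rcons. Qed.

Lemma sig_cat i x y : sig i (x ++ y) =
  (lows i x + (lows i y - highs i x), highs i y + (highs i x - lows i y)).
Proof.
elim/last_ind: y => [|y c IH].
  by rewrite cats0 /= sub0n subn0 addn0 add0n -surjective_pairing.
rewrite -rcons_cat !sig_rcons IH /sig_step /code /=.
by case: ifP => _ /=; [|case: ifP => _ /=]; congr pair; lia.
Qed.

Lemma sig_free i w : all (fun c => (c != i) && (c != i.+1)) w -> sig i w = (0, 0).
Proof.
elim/last_ind: w => // w c IH; rewrite all_rcons sig_rcons.
by case/andP=> /andP[/negbTE h1 /negbTE h2] /IH ->; rewrite /code h1 h2.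
Qed.

Lemma sig_balance i w :
  lows i w + count_mem i.+1 w = highs i w + count_mem i w.
Proof.
elim/last_ind: w => // w c; rewrite sig_rcons -cats1 !count_cat /= /sig_step /code /=.
case: eqP => [->|_] /=; first by rewrite (gtn_eqF (ltnSn i)); lia.
by case: eqP => _ /=; lia.
Qed.

Lemma sig_nseq_high i m : sig i (nseq m i.+1) = (0, m).
Proof.
elim: m => // m IH; rewrite -addn1 nseqD cats1 sig_rcons IH /sig_step /code eqxx /=.
by rewrite addn1.
Qed.

Lemma sig_low i w : all (fun c => c <= i) w -> sig i w = (count_mem i w, 0).
Proof.
elim/last_ind: w => // w c IH; rewrite all_rcons sig_rcons => /andP[ci /IH ->].
rewrite -cats1 count_cat /= /sig_step /code /= (ltn_eqF (_ : c < i.+1)) //=.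
by case: eqP => _ /=; rewrite ?addn0.
Qed.

(** * The signature rule for the raising and lowering operators *)

(** The cancellation of positions computes the signature: what remains is a
    word of i's followed by a word of (i+1)'s, so that an incoming i is cancelled
    exactly when some i+1 is pending. *)
Lemma sig_unmatched_pos w i t :
  let R := rev (foldl (cancel_step w i) [::]
             [seq p <- t | (nth 0 w p == i) || (nth 0 w p == i.+1)]) in
  (cnt w i R, cnt w i.+1 R) = sig i (map (nth 0 w) t).
Proof.
elim/last_ind: t => // t p; rewrite filter_rcons map_rcons sig_rcons.
set s := [seq q <- t | _] => /= <-.
have [A [B [E hA hB]]] : exists A B, [/\ rev (foldl (cancel_step w i) [::] s) = A ++ B,
    all (fun q => nth 0 w q == i) A & all (fun q => nth 0 w q == i.+1) B].
  by apply: red_sorted; apply: filter_all.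
rewrite /sig_step /code /=.
have cntA : cnt w i.+1 A = 0.
  apply/eqP; rewrite -leqn0 leqNgt -has_count; apply/hasPn => q /(allP hA) /eqP ->.
  by rewrite ltn_eqF.
have cnt_rcons a U q : cnt w a (rcons U q) = cnt w a U + (nth 0 w q == a).
  by rewrite -cats1 /cnt count_cat /= addn0.
case: (boolP (_ || _)) => [lp|]; last first.
  by rewrite negb_or => /andP[/negbTE -> /negbTE ->].
rewrite red_rcons E; case/lastP: B hB E => [|B q] hB E.
- rewrite !cats0 cntA eqxx addn1; case/lastP: A hA E cntA => [|A q].
    by rewrite /cnt /=; case/orP: lp => /eqP -> _ _ _;
      rewrite ?eqxx ?(gtn_eqF (ltnSn i)) ?(ltn_eqF (ltnSn i)).
  rewrite all_rcons last_rcons => /andP[/eqP -> _] _ c0.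
  rewrite (ltn_eqF (ltnSn i)) andbF /= !(cnt_rcons _ (rcons A q)) c0.
  by case/orP: lp => /eqP ->;
    rewrite ?eqxx ?(gtn_eqF (ltnSn i)) ?(ltn_eqF (ltnSn i)) ?addn0 ?addn1.
- move: hB; rewrite all_rcons -rcons_cat last_rcons => /andP[/eqP lq hB].
  have -> : rcons (A ++ B) q != [::] by case: (A ++ B).
  rewrite lq eqxx /= size_rcons /=.
  case/orP: lp => /eqP lp; rewrite lp ?eqxx ?(gtn_eqF (ltnSn i)) ?(ltn_eqF (ltnSn i)).
    rewrite -cats1 take_size_cat // cats1 !cnt_rcons lq eqxx (gtn_eqF (ltnSn i)).
    by rewrite addn1 !addn0.
  by rewrite !cnt_rcons lp lq eqxx (gtn_eqF (ltnSn i)) !addn0 !addn1.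
Qed.

Lemma size_unmatched w i :
  (size (unmatched w i i), size (unmatched w i i.+1)) = sig i w.
Proof.
by rewrite !size_filter -[w in RHS]take_size -(map_nth_iota0 0 (leqnn _)) -sig_unmatched_pos.
Qed.

(** The smaller of the two letters exchanged by the operators for i; the queer
    index None exchanges the letters 0 and 1. *)
Definition lo {n} (i : option 'I_n.-1) : nat := if i is Some k then k : nat else 0.

(** The condition for the operators for i to change a letter between x and y.
    It is the same for raising and lowering. *)
Definition cut {n} (i : option 'I_n.-1) (x y : seq nat) : bool :=
  if i is Some k then (highs k x == 0) && (lows k y == 0) else all (leq 2) x.

Definition mark {n} (i : option 'I_n.-1) (c : nat) (w : seq nat) (p : nat) : bool :=
  [&& p < size w, nth 0 w p == c & cut i (take p w) (drop p.+1 w)].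

(** Raising (up) and lowering (~~ up) operators are treated together, since
    they only differ by exchanging lo i and (lo i).+1. *)
Definition raw_act {n} (up : bool) (i : option 'I_n.-1) (T : seq (seq nat)) : option (seq (seq nat)) :=
  if up then raw_op raw_e raw_ebar i T else raw_op raw_f raw_fbar i T.

Lemma split_at (w : seq nat) p : p < size w ->
  w = take p w ++ nth 0 w p :: drop p.+1 w.
Proof. by move=> pw; rewrite -drop_nth // cat_take_drop. Qed.

(** Between two boxes that could both be changed, the word z would have no
    surviving letter, and then one of the two letters c survives on the
    wrong side of the other. *)
Lemma cut_once {n} (i : option 'I_n.-1) (b : bool) x z y (c := lo i + b) :
  cut i x (z ++ c :: y) -> cut i (x ++ c :: z) y -> False.
Proof.
rewrite {}/c; case: i b => [k|] b /=; last first.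
  by rewrite all_cat; case: b => /= _; rewrite andbF.
case/andP=> _ h1 /andP[h2 _]; move: h1 h2.
rewrite -[_ :: y]cat1s -[_ :: z]cat1s !sig_cat /=; case: b => /=.
  by rewrite addn1 (sig_nseq_high k 1) /=; lia.
by rewrite addn0 (sig_low k [:: k : nat]) /= ?eqxx ?leqnn //=; lia.
Qed.

Lemma mark_uniq {n} (i : option 'I_n.-1) (b : bool) w p q :
  mark i (lo i + b) w p -> mark i (lo i + b) w q -> p = q.
Proof.
wlog pq : p q / p < q.
  by move=> H mp mq; case: (ltngtP p q) => // h; [apply: H|apply/esym; apply: H].
move=> /and3P[pw /eqP np cp] /and3P[qw /eqP nq cq]; exfalso.
have ex : take q w = take p w ++ lo i + b :: drop p.+1 (take q w).
  by rewrite -[LHS](cat_take_drop p) take_takel ?(ltnW pq) // (drop_nth 0)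
    ?size_takel ?(ltnW qw) // nth_take // np.
have ey : drop p.+1 w = drop p.+1 (take q w) ++ lo i + b :: drop q.+1 w.
  rewrite {1}(split_at w q qw) nq {1}ex -(cat_rcons _ (take p w)) -catA drop_size_cat //.
  by rewrite size_rcons size_takel // ltnW.
by rewrite ex in cq; rewrite ey in cp; apply: cut_once cp cq.
Qed.

Lemma mark_exists_low {n} (k : 'I_n.-1) w p : mark (Some k) k w p -> 0 < lows k w.
Proof.
case/and3P=> pw /eqP np /andP[h1 _].
rewrite (split_at w p pw) np -cat1s !sig_cat /= (sig_low k [:: k : nat]) /= ?leqnn //.
by rewrite eqxx; lia.
Qed.

Lemma mark_exists_high {n} (k : 'I_n.-1) w p : mark (Some k) k.+1 w p -> 0 < highs k w.
Proof.
case/and3P=> pw /eqP np /andP[_ h1].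
rewrite (split_at w p pw) np -cat1s !sig_cat /= (sig_nseq_high k 1) /=.
by lia.
Qed.

Lemma unmatched_mark {n} (k : 'I_n.-1) w s1 p s2 :
  unmatched w k k ++ unmatched w k k.+1 = s1 ++ p :: s2 ->
  all (fun q => nth 0 w q == k) s1 -> all (fun q => nth 0 w q == k.+1) s2 ->
  mark (Some k) (nth 0 w p) w p.
Proof.
rewrite -unmatched_form => E h1 h2.
have [s [t [es r1 r2]]] := red_split E.
have [t1 [t2 [et e1 e2]]] := filter_split es.
have [pw ez1 ez2] := iota_split et.
rewrite /mark pw eqxx /=.
have -> : take p w = map (nth 0 w) t1 by rewrite ez1 map_nth_iota0 // ltnW.
have -> : drop p.+1 w = map (nth 0 w) t2.
  by rewrite ez2 map_nth_iota ?take_oversize ?size_drop // subnKC.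
have := sig_unmatched_pos w k t1; have := sig_unmatched_pos w k t2.
rewrite /= e1 r1 e2 r2 => <- <-.
rewrite /= !eqn0Ngt -!has_count.
apply/andP; split; apply/hasPn => q.
  by move/(allP h1)/eqP->; rewrite ltn_eqF.
by move/(allP h2)/eqP->; rewrite gtn_eqF.
Qed.

(** For the queer index, a box is determined before its letter is known: it is
    the first one with a letter 0 or 1. *)
Lemma pos0_spec {n} w :
  if pos_i w 0 is p :: _ then mark (None : option 'I_n.-1) (nth 0 w p) w p /\ nth 0 w p < 2
  else forall q c, c < 2 -> ~~ mark (None : option 'I_n.-1) c w q.
Proof.
case E : (pos_i w 0) => [|p s].
  move=> q c c2; apply/negP => /and3P[qw /eqP nq _].
  have : q \in pos_i w 0.
    by rewrite mem_filter mem_iota qw nq; case: c c2 {nq} => [|[]].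
  by rewrite E.
have [pw fp] := pos0_split E; rewrite /mark pw eqxx; split; first exact/allP.
have : p \in pos_i w 0 by rewrite E mem_head.
by rewrite mem_filter; case: (nth 0 w p) => [|[]].
Qed.

Lemma mark_queer_before {n} c w p q : mark (None : option 'I_n.-1) c w q -> p < q -> 1 < nth 0 w p.
Proof.
case/and3P=> qw _ /allP cq pq; apply: cq.
by rewrite -(nth_take 0 pq) mem_nth // size_takel // ltnW.
Qed.

Lemma raw_act_spec {n} (up : bool) (i : option 'I_n.-1) T :
  (exists2 p, mark i (lo i + up) (rd T) p &
     raw_act up i T = Some (change T p (lo i + ~~ up))) \/
  (forall p, ~~ mark i (lo i + up) (rd T) p) /\ raw_act up i T = None.
Proof.
have [sl sh] : (forall k, size (unmatched (rd T) k k) = lows k (rd T)) /\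
    (forall k, size (unmatched (rd T) k k.+1) = highs k (rd T)).
  by split=> k; rewrite -size_unmatched.
case: i => [k|].
- case: up; rewrite /raw_act /= ?addn1 ?addn0 /raw_e /raw_f.
  + case E : (unmatched _ _ _) => [|p s].
      right; split=> // p; apply/negP => /mark_exists_high.
      by rewrite -sh E.
    have np : nth 0 (rd T) p = k.+1.
      by apply: (@unmatched_nth _ k); rewrite E mem_head.
    left; exists p => //; rewrite -np.
    apply: (unmatched_mark _ _ (unmatched (rd T) k k) _ s); rewrite -?E //.
      exact: all_unmatched.
    by have := all_unmatched (rd T) k k.+1; rewrite E => /andP[].
  + case E : (unmatched _ _ _) => [|p0 s].
      right; split=> // p; apply/negP => /mark_exists_low.
      by rewrite -sl E.
    move: E; rewrite lastI; move: (belast _ _) (last _ _) => s1 p E.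
    have np : nth 0 (rd T) p = k.
      by apply: (@unmatched_nth _ k); rewrite E mem_rcons mem_head.
    left; exists p => //; rewrite -[in mark _ _]np.
    apply: (unmatched_mark _ _ s1 _ (unmatched (rd T) k k.+1)).
    * by rewrite E cat_rcons.
    * by have := all_unmatched (rd T) k k; rewrite E all_rcons => /andP[].
    * exact: all_unmatched.
- have := @pos0_spec n (rd T); rewrite /raw_act /= /raw_ebar /raw_fbar.
  case: (pos_i (rd T) 0) => [h|p _ [mp np]].
    by right; split; [move=> p; apply: h; case: up|case: up].
  have [ep|ne] := eqVneq (nth 0 (rd T) p) up.
    by left; exists p; [rewrite -[nat_of_bool up]ep|case: up ep => /= ->].
  right; split; last by case: up ne np; case: (nth 0 _ _) => [|[]].
  move=> q; apply/negP => mq; have [_ /eqP nq _] := and3P mq.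
  case: (ltngtP p q) => [pq|qp|e]; last by rewrite e nq eqxx in ne.
    by have := mark_queer_before _ _ _ _ mq pq; rewrite ltnNge -ltnS np.
  by have := mark_queer_before _ _ _ _ mp qp; rewrite nq; case: (up).
Qed.

(** The box changed by an operator is the only box of the given letter that
    satisfies the condition [cut]. This turns the search for a position into a
    condition on the two words around it. *)
Lemma raw_actP {n} (up : bool) (i : option 'I_n.-1) T T' : raw_act up i T = Some T' <->
  exists2 p, mark i (lo i + up) (rd T) p & T' = change T p (lo i + ~~ up).
Proof.
case: (raw_act_spec up i T) => [[p mp ->]|[no ->]]; split.
- by move=> [<-]; exists p.
- by move=> [q mq ->]; rewrite (mark_uniq _ _ _ _ _ mq mp).
- by [].
- by move=> [q mq]; have := no q; rewrite mq.
Qed.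

(** * Changing one box *)

Lemma set_nth_at (w : seq nat) p c : p < size w ->
  set_nth 0 w p c = take p w ++ c :: drop p.+1 w.
Proof.
move=> pw; rewrite -[RHS](set_nth_size_cat _ _ (nth 0 w p)).
by rewrite size_takel ?(ltnW pw) // -split_at.
Qed.

Lemma size_rd T : size (rd T) = sumn (shape T).
Proof.
rewrite size_flatten /shape -map_comp; congr sumn.
by apply: eq_map => r /=; rewrite size_rev.
Qed.

Lemma rd_change T p c : p < size (rd T) ->
  rd (change T p c) = set_nth 0 (rd T) p c /\ shape (change T p c) = shape T.
Proof.
move=> pT; have sz : size (set_nth 0 (rd T) p c) = sumn (shape T).
  by rewrite size_set_nth (maxn_idPr pT) size_rd.
rewrite /change /unrd /rd; split.
  by rewrite -map_comp map_id_in ?reshapeKr ?sz // => r _ /=; rewrite revK.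
rewrite -[RHS](reshapeKl (sh := shape T) (s := set_nth 0 (rd T) p c)) ?sz //.
by rewrite /shape -map_comp; apply: eq_map => r /=; rewrite size_rev.
Qed.

Lemma mark_set {n} (i : option 'I_n.-1) c c' w p :
  mark i c w p -> mark i c' (set_nth 0 w p c') p.
Proof.
case/and3P=> pw _ cp; rewrite /mark size_set_nth (maxn_idPr pw) pw /=.
rewrite nth_set_nth /= !eqxx /= set_nth_at // take_size_cat ?size_takel ?(ltnW pw) //.
by rewrite -cat_rcons drop_size_cat // size_rcons size_takel ?(ltnW pw).
Qed.

(** The change of the box leaves the words on both sides unchanged, and [cut]
    only depends on these. *)
Lemma raw_act_inv {n} (up : bool) (i : option 'I_n.-1) T T' :
  raw_act up i T = Some T' -> raw_act (~~ up) i T' = Some T.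
Proof.
case/raw_actP=> p mp ->; apply/raw_actP; exists p; have [pT /eqP np _] := and3P mp.
  by rewrite (rd_change _ _ _ pT).1; apply: mark_set mp.
have [e1 e2] := rd_change T p (lo i + ~~ up) pT.
rewrite negbK -np {1}/change e1 e2 set_set_nth eqxx /=.
by rewrite set_nth_at // np -np -split_at // unrdK.
Qed.

Lemma sig_set {n} (up : bool) (k : 'I_n.-1) w p :
  mark (Some k) (k + up) w p -> let w' := set_nth 0 w p (k + ~~ up) in
  lows k w' + ~~ up = lows k w + up /\ highs k w' + up = highs k w + ~~ up.
Proof.
case/and3P=> pw /eqP np /andP[/eqP h1 /eqP h2]; rewrite set_nth_at //=.
rewrite [in lows k w](split_at w p pw) [in highs k w](split_at w p pw) np.
rewrite -[_ :: _]cat1s -[k + up :: _]cat1s !sig_cat /= h1 h2.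
case: up {np} => /=; rewrite !addn1 !addn0 (sig_nseq_high k 1) (sig_low k [:: k : nat]) /=;
  rewrite ?leqnn ?eqxx //=; lia.
Qed.

Lemma count_set (w : seq nat) p c a : p < size w ->
  count_mem a (set_nth 0 w p c) + (nth 0 w p == a) = count_mem a w + (c == a).
Proof.
move=> pw; rewrite set_nth_at // [in RHS](split_at w p pw) !count_cat /=.
by lia.
Qed.

Lemma sig_code i w w' : map (code i) w = map (code i) w' -> sig i w = sig i w'.
Proof. by rewrite /sig => ->. Qed.

Lemma map_code_set i (w : seq nat) p c : p < size w -> code i (nth 0 w p) = code i c ->
  map (code i) (set_nth 0 w p c) = map (code i) w.
Proof.
move=> pw e; rewrite set_nth_at // [in RHS](split_at w p pw) !map_cat /=.
by rewrite e.
Qed.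

Lemma mark_code {n} (i : option 'I_n.-1) (b : bool) w w' p :
  map (code (lo i)) w = map (code (lo i)) w' ->
  mark i (lo i + b) w p = mark i (lo i + b) w' p.
Proof.
move=> e; have sz : size w = size w' by rewrite -(size_map (code (lo i))) e size_map.
rewrite /mark sz; case: (boolP (p < size w')) => //= pw'.
have := congr1 (fun s => nth (code (lo i) 0) s p) e.
rewrite !(nth_map 0) ?sz // => ep; congr andb.
  by have [e1 e2] := ep; case: b; rewrite ?addn1 ?addn0.
have et : map (code (lo i)) (take p w) = map (code (lo i)) (take p w').
  by rewrite !map_take e.
have ed : map (code (lo i)) (drop p.+1 w) = map (code (lo i)) (drop p.+1 w').
  by rewrite !map_drop e.
case: i {e sz ep} et ed => [k|] /= et ed.
  by rewrite (sig_code _ _ _ et) (sig_code _ _ _ ed).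
have tr u : all (leq 2) u = all (pred1 (false, false)) (map (code 0) u).
  by rewrite all_map; apply: eq_all => -[|[|c]].
by rewrite !tr et.
Qed.

(** When the letters exchanged by the two operators have no code for each
    other, each operator finds its box before and after the other has acted. *)
Lemma raw_act_comm {n} (up vp : bool) (i j : option 'I_n.-1) T T1 T2 :
  code (lo j) (lo i) = (false, false) -> code (lo j) (lo i).+1 = (false, false) ->
  code (lo i) (lo j) = (false, false) -> code (lo i) (lo j).+1 = (false, false) ->
  raw_act up i T = Some T1 -> raw_act vp j T1 = Some T2 ->
  obind (raw_act up i) (raw_act vp j T) = Some T2.
Proof.
move=> ji ji1 ij ij1.
have cji (b : bool) : code (lo j) (lo i + b) = (false, false).
  by case: b; rewrite ?addn1 ?addn0.
have cij (b : bool) : code (lo i) (lo j + b) = (false, false).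
  by case: b; rewrite ?addn1 ?addn0.
case/raw_actP=> p mp -> /raw_actP[q mq ->].
have [pT /eqP np _] := and3P mp; have [e1 e2] := rd_change T p (lo i + ~~ up) pT.
have mq' : mark j (lo j + vp) (rd T) q.
  rewrite e1 in mq; rewrite (mark_code _ _ _ (set_nth 0 (rd T) p (lo i + ~~ up))) //.
  by apply: esym; apply: map_code_set => //; rewrite np !cji.
have [qT /eqP nq _] := and3P mq'.
have [f1 f2] := rd_change T q (lo j + ~~ vp) qT.
have -> : raw_act vp j T = Some (change T q (lo j + ~~ vp)).
  by apply/raw_actP; exists q.
apply/raw_actP; exists p.
  rewrite f1 (mark_code _ _ _ (rd T)) //.
  by apply: map_code_set => //; rewrite nq !cij.
rewrite ![change (change _ _ _) _ _]/change e1 e2 f1 f2 set_set_nth.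
(* The boxes are different, as their letters are. *)
case: eqP => // epq; move: (cji up); rewrite -np epq nq /code.
by case: (vp); rewrite ?addn1 ?addn0 eqxx.
Qed.

(** * Hook words *)

Lemma subseq_catr_split (u s1 s2 : seq nat) : subseq u (s1 ++ s2) ->
  exists u1 u2, [/\ u = u1 ++ u2, subseq u1 s1 & subseq u2 s2].
Proof.
case/subseqP=> m sm ->; exists (mask (take (size s1) m) s1), (mask (drop (size s1) m) s2).
rewrite !mask_subseq; split=> //.
by rewrite -mask_cat ?cat_take_drop // size_takel // sm size_cat leq_addr.
Qed.

Lemma hook_word1 c : hook_word [:: c].
Proof. exact: (@hookI [:: c] [::]). Qed.

Lemma hook_word_subseq u v : hook_word u -> subseq v u -> v != [::] -> hook_word v.
Proof.
case/hook_wordP=> D [U [-> Dn sD pU]] /subseq_catr_split[v1 [v2 [-> s1 s2]]] vn.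
have sU : sorted ltn v2 := subseq_sorted ltn_trans s2 (path_sorted pU).
have [e1|n1] := eqVneq v1 [::].
  move: sU vn; rewrite e1; case: (v2) => //= c w pw _.
  exact: (@hookI [:: c] w).
have sv1 : pairwise geq v1 := subseq_pairwise s1 sD.
case: v2 {s2 vn} sU => [|c w] sU; first by apply: hookI => //; apply/eqP.
(* The first ascending letter of u may continue the descending part of v. *)
have [ltc|cle] := ltnP (last 0 v1) c.
  by apply: hookI; rewrite ?ltc //=; [apply/eqP|rewrite ltc].
rewrite -cat_rcons; apply: hookI; rewrite ?last_rcons //; first by case: (v1).
rewrite -cats1; apply: pairwise_geq_catI => // x y xv; rewrite inE => /eqP ->.
apply: leq_trans cle _; case/lastP: v1 sv1 xv {s1 n1} => // v1 d.
rewrite last_rcons -cats1 pairwise_cat mem_cat inE => /and3P[/allrelP h _ _].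
by case/orP=> [xv|/eqP -> //]; apply: h; rewrite ?mem_head.
Qed.

Lemma hook_word_peak c a x : c < a -> x <= a -> ~~ hook_word [:: c; a; x].
Proof.
move=> ca xa; apply/negP => /hook_wordP[[|d [|d' D]] [U [// [<-] E Dn]]] /=.
  by rewrite -E /= => _ /and3P[_]; rewrite ltnNge xa.
by case: E => <- _; rewrite leqNgt ca.
Qed.

Lemma hook_word_cons c w : hook_word w -> head 0 w <= c -> hook_word (c :: w).
Proof.
case/hook_wordP=> [[|d D] [U [-> // _ sD pU]]] /= dc.
apply: (@hookI (c :: d :: D) U) => //=; rewrite dc; move: sD => /= /andP[h ->].
by rewrite h !andbT; apply/allP => x /(allP h) /= xd; apply: leq_trans xd dc.
Qed.

(** If b were at least the first letter of r, then b :: r would be a hook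
    subword longer than r. *)
Lemma max_hook_lt_head r r' b : nilp r || hook_word r ->
  max_hook (r' ++ r) (size r) -> b \in r' -> (r != [::]) && (b < head 0 r).
Proof.
move=> hr /max_hookP mx br'; rewrite -sub1seq in br'.
have rn : r != [::].
  apply/eqP => e; move: mx; rewrite e => /(_ [:: b]); rewrite cats0 ltn0.
  by move/(_ br' (hook_word1 b)).
rewrite rn ltnNge; apply/negP => le; move: hr; rewrite /nilp size_eq0 (negbTE rn) /= => hr.
have := mx (b :: r) (cat_subseq br' (subseq_refl r)) (hook_word_cons _ _ hr le).
by rewrite /= ltnn.
Qed.

(** The e letters i+1 of the descending part of r are at its beginning. Putting
    the letters i of r' in their place gives a hook subword of r' ++ r; hence
    there are at most e of them. Read from right to left, r ends with its
    letters i+1, which are therefore not cancelled within r. *)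
Lemma leading_high i r r' : nilp r || hook_word r ->
  all (fun c => c <= i.+1) r -> max_hook (r' ++ r) (size r) ->
  count_mem i r' <= highs i (rev r).
Proof.
move=> hr /allP r_le mx; have [->//|] := posnP (count_mem i r').
rewrite -has_count has_pred1 => ir'.
have /andP[rn _] := max_hook_lt_head _ _ _ hr mx ir'.
move: hr; rewrite /nilp size_eq0 (negbTE rn) => /hook_wordP[D [U [er Dn sD pU]]].
have D_le : {in D, forall b, b <= i.+1} by move=> b bD; apply: r_le; rewrite er mem_cat bD.
set e := count_mem i.+1 D; set D' := [seq b <- D | b < i.+1].
have eD : D = nseq e i.+1 ++ D' := geq_split_high sD D_le.
have le_e : e <= highs i (rev r).
  rewrite er eD -catA rev_cat rev_nseq sig_cat /= sig_nseq_high /=; exact: leq_addr.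
apply: leq_trans le_e; set c := count_mem i r'.
have c0 : 0 < c by rewrite -has_count has_pred1.
have hk : hook_word ((nseq c i ++ D') ++ U).
  apply: hookI.
  - by case: (c) c0.
  - apply: pairwise_geq_catI; first exact: pairwise_geq_nseq.
      by move: sD; rewrite eD pairwise_cat => /and3P[].
    by move=> x y /nseqP[-> _]; rewrite mem_filter => /andP[].
  - apply: path_ltn_weak pU; rewrite eD !last_cat.
    case: (D') eD => [|d D''] //= eD; move: Dn; rewrite eD cats0.
    have lst x k : 0 < k -> last 0 (nseq k x) = x.
      by case: k => //= k _; elim: k.
    by case: (posnP e) => [->|e0] // _; rewrite !lst.
have := (max_hookP _ _ mx) _ _ hk.
rewrite -catA size_cat size_nseq er eD -catA 2!size_cat size_nseq leq_add2r; apply.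
rewrite cat_subseq ?subseq_nseq //.
exact: suffix_subseq.
Qed.

(** A hook subword u of the padded rows is h1 h2 h3 h4, with h1 and h3 among
    the added letters. If h3 is empty, then h2 h4 is a hook subword of r' ++ r.
    If h1 h2 is empty, then the size is bounded by the whole row. Otherwise h3
    starts an ascent to a, the largest letter present, so that u ends there;
    then u has at most m' + size r + 1 letters, whence the need for m' < m. *)
Lemma max_hook_pad r r' a b m m' : b < a -> (m' < m) || (m' == 0) ->
  all (fun c => c <= a) r -> all (fun c => c < a) r' ->
  max_hook (r' ++ r) (size r) ->
  max_hook ((nseq m' b ++ r') ++ nseq m a ++ r) (size (nseq m a ++ r)).
Proof.
move=> ba mm r_le r'_lt /max_hookP mx; apply/max_hookP => u su hu.
have [v [w [eu sv sw]]] := subseq_catr_split _ _ _ su.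
have [h1 [h2 [ev s1 s2]]] := subseq_catr_split _ _ _ sv.
have [h3 [h4 [ew s3 s4]]] := subseq_catr_split _ _ _ sw.
have sub x : subseq x (r' ++ r) -> subseq x u -> size x <= size r.
  by move=> sx xu; case: (eqVneq x [::]) => [-> //|/(hook_word_subseq _ _ hu xu)]; apply: mx.
have l1 : size h1 <= m' by have := size_subseq s1; rewrite size_nseq.
have l3 : size h3 <= m by have := size_subseq s3; rewrite size_nseq.
have l4 : size h4 <= size r by apply: size_subseq s4.
rewrite eu ev ew !size_cat size_nseq.
case: h3 s3 l3 ew => [|c h3] s3 l3 ew.
  have : size (h2 ++ h4) <= size r.
    apply: sub; first exact: cat_subseq.
    by rewrite eu ev ew -catA suffix_subseq.
  by rewrite size_cat /=; case/orP: mm l1 => [|/eqP ->]; lia.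
have [hv|hv] := eqVneq v [::].
  move: (congr1 size ev); rewrite hv size_cat => /esym/eqP; rewrite addn_eq0.
  by case/andP=> /eqP -> /eqP ->; move: l3 => /=; lia.
have ec : c = a.
  by have /nseqP[] : c \in nseq m a by apply: (mem_subseq s3); rewrite mem_head.
have : size h2 <= size r.
  apply: sub; first exact: subseq_trans s2 (prefix_subseq _ _).
  by rewrite eu ev -catA; apply: subseq_trans (prefix_subseq _ w) (suffix_subseq _ _).
have rest : h3 ++ h4 = [::].
  case er : (h3 ++ h4) => [//|x y].
  have xa : x <= a.
    have : x \in nseq m a ++ r.
      by apply: (mem_subseq sw); rewrite ew /= er inE mem_head orbT.
    by rewrite mem_cat => /orP[/nseqP[-> //]|/(allP r_le)].
  have [d [dv da]] : exists d, d \in v /\ d < a.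
    have : head 0 v \in v by case: (v) hv => // d v' _; rewrite mem_head.
    exists (head 0 v); split => //; have := mem_subseq sv H.
    by rewrite mem_cat => /orP[/nseqP[-> //]|/(allP r'_lt)].
  have : hook_word [:: d; a; x].
    apply: hook_word_subseq hu _ _ => //; rewrite eu ew /= er ec.
    rewrite -[[:: d; a; x]]/([:: d] ++ [:: a; x]); apply: cat_subseq.
      by rewrite sub1seq.
    by rewrite /= !eqxx sub0seq.
  by rewrite (negbTE (hook_word_peak _ _ _ da xa)).
move: (congr1 size rest); rewrite size_cat /=; case/orP: mm l1 l3 => [|/eqP ->] /=; lia.
Qed.

(** * The staircase shape of a semistandard decomposition tableau *)

(** Semistandardness, with the bound on the letters sharpened to the number of
    rows below; the sharpening makes the condition stable under removing
    upper rows, hence suited to induction. *)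
Fixpoint staircase (T : seq (seq nat)) : bool :=
  if T is r :: T' then
    [&& all (fun c => c <= size T') r, nilp r || hook_word r,
        max_hook (head [::] T' ++ r) (size r) & staircase T']
  else true.

Lemma max_hook_size r : max_hook r (size r).
Proof. by apply/max_hookP => u /size_subseq. Qed.

Lemma staircase_all T N : size T <= N -> staircase T -> all (all (fun c => c < N)) T.
Proof.
elim: T => //= r T IH sT /and4P[h _ _ /IH ->]; last exact: ltnW.
by rewrite andbT; apply: sub_all h => c hc; apply: leq_ltn_trans hc sT.
Qed.

Lemma staircase_rows T : staircase T ->
  all (fun r => nilp r || hook_word r) T /\
  sorted (fun r r' => max_hook (r' ++ r) (size r)) T.
Proof.
elim: T => //= r T IH /and4P[_ -> h /IH[-> s]]; split => //.
by case: T h s {IH} => //= r' T -> ->.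
Qed.

(** The first row is bounded by hypothesis, and the bound decreases by one from
    each row to the next by [max_hook_lt_head]. *)
Lemma staircase_of_rows T : all (fun c => c < size T) (head [::] T) ->
  all (fun r => nilp r || hook_word r) T ->
  sorted (fun r r' => max_hook (r' ++ r) (size r)) T -> staircase T.
Proof.
elim: T => //= r T IH h1 /andP[hr h2] h3; rewrite h1 hr /=.
case: T h1 h2 h3 IH => [|r' T] h1 h2 h3 IH /=; first by rewrite max_hook_size.
case/andP: h3 => h3 h4; rewrite h3 /=; apply: IH => //.
apply/allP => b br'; have /andP[rn lt] := max_hook_lt_head _ _ _ hr h3 br'.
rewrite /= -ltnS; apply: leq_ltn_trans lt _.
by apply: (allP h1); case: (r) rn => //= c r0 _; rewrite mem_head.
Qed.

Lemma staircase_cat T1 T2 : staircase (T1 ++ T2) -> staircase T2.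
Proof. by elim: T1 => //= r T1 IH /and4P[_ _ _ /IH]. Qed.

Lemma size_parts n (v : 'rV[int]_n) : size (parts v) = n.
Proof. by rewrite size_map size_enum_ord. Qed.

Lemma is_SDT_size n (v : 'rV[int]_n) T : is_SDT v T -> size T = n.
Proof. by case/and4P=> /eqP e _ _ _; rewrite -(size_map size) -[map _ _]/(shape T) e size_parts. Qed.

(** The shape, which fixes the number of rows, is the only condition that
    involves the partition. *)
Lemma is_SDTE n (v : 'rV[int]_n) T : is_SDT v T = (shape T == parts v) && staircase T.
Proof.
apply/idP/andP => [h|[/eqP sh w]].
  have sT := is_SDT_size _ _ _ h; have /and4P[h1 h2 h3 h4] := h.
  split=> //; apply: staircase_of_rows => //.
  by rewrite sT; case: (T) h2 => //= r T' /andP[].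
have sT : size T = n by rewrite -(size_map size) -[map _ _]/(shape T) sh size_parts.
have [h3 h4] := staircase_rows _ w.
by apply/and4P; split => //; [rewrite sh|apply: staircase_all => //; rewrite sT].
Qed.

(** * Adding boxes on the left of the rows *)

(** A recursive form of [add_boxes], on a tableau above which rows have been
    removed; its letters are those for k further rows below. *)
Fixpoint pad (k : nat) (ms : seq nat) (T : seq (seq nat)) : seq (seq nat) :=
  match ms, T with
  | m :: ms', r :: T' => (nseq m (size T' + k) ++ r) :: pad k ms' T'
  | _, _ => [::]
  end.

(** Strictly decreasing up to trailing zeros. *)
Definition strict (ms : seq nat) : bool :=
  sorted (fun m m' => (m' < m) || (m' == 0)) ms.

Lemma size_pad k ms T : size ms = size T -> size (pad k ms T) = size T.
Proof. by elim: ms T => [|m ms IH] [|r T] //= [/IH ->]. Qed.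

Lemma pad_cat k ms1 ms2 T1 T2 : size ms1 = size T1 ->
  pad k (ms1 ++ ms2) (T1 ++ T2) = pad (size T2 + k) ms1 T1 ++ pad k ms2 T2.
Proof.
by elim: ms1 T1 => [|m ms1 IH] [|r T1] //= [/IH ->]; rewrite size_cat addnA.
Qed.

Lemma nth_pad k ms T j : size ms = size T -> j < size T ->
  nth [::] (pad k ms T) j = nseq (nth 0 ms j) (size T - j.+1 + k) ++ nth [::] T j.
Proof.
elim: ms T j => [|m ms IH] [|r T] // [|j] [sz] jT; first by rewrite /= subn1.
by rewrite /= IH // subSS.
Qed.

Lemma add_boxes_pad n (mu : 'rV[int]_n) T : size T = n ->
  add_boxes mu T = pad 0 (parts mu) T.
Proof.
move=> sT; have sz : size (parts mu) = size T by rewrite size_parts.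
apply: (@eq_from_nth _ [::]); rewrite size_mkseq ?size_pad // => j jn.
by rewrite nth_mkseq // (nth_pad 0 _ _ _ sz) ?sT // addn0.
Qed.

Lemma staircase_pad ms T : size ms = size T -> strict ms -> staircase T -> staircase (pad 0 ms T).
Proof.
elim: ms T => [|m ms IH] [|r T] //= [sz] st /and4P[h1 h2 h3 h4].
rewrite IH //; last exact: path_sorted st.
rewrite size_pad // addn0 andbT; apply/and3P; split.
- by rewrite all_cat h1 all_nseq leqnn orbT.
- case: m {st} => [|m] //=; elim: m => [|m IHm] /=.
    case/orP: h2 => [/nilP ->|h2]; first exact: hook_word1.
    by apply: hook_word_cons => //; case: (r) h1 => //= c r' /andP[].
  exact: hook_word_cons.
- case: ms T sz st h1 h3 h4 {IH} => [|m' ms] [|r' T] //= _ st h1 h3 h4.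
    exact: max_hook_size.
  case/andP: st => st _; rewrite addn0; apply: max_hook_pad => //.
  by case/and4P: h4.
Qed.

(** * Signatures of padded tableaux *)

Lemma sig_nseq_other i c m : i.+1 < c -> sig i (nseq m c) = (0, 0).
Proof.
move=> ic; apply: sig_free; rewrite all_nseq; apply/orP; right.
by rewrite !gtn_eqF // ltnW.
Qed.

Lemma sig_below i T : staircase T -> size T <= i -> sig i (rd T) = (0, 0).
Proof.
move=> w sT; apply: sig_free; apply/allP => c /flattenP[_ /mapP[r rT ->]].
rewrite mem_rev => cr; have ci : c < i := allP (allP (staircase_all _ _ sT w) r rT) c cr.
by rewrite !ltn_eqF // ltnW.
Qed.

(** Letters i occur down to the row with i rows below it, and letters i+1 only
    above it. *)
Lemma sig_home i r T : staircase (r :: T) -> size T = i ->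
  sig i (rd (r :: T)) = (count_mem i r, 0).
Proof.
case/and4P=> h1 _ _ w sT; rewrite rd_cons sig_cat (sig_below i T) ?sT //.
rewrite (sig_low i (rev r)) ?count_rev ?all_rev; last by rewrite -sT.
by rewrite /= sub0n addn0.
Qed.

Lemma strict_leq m m' ms : strict [:: m, m' & ms] -> m' <= m.
Proof. by case/andP=> /orP[/ltnW|/eqP ->]. Qed.

(** The letters i of the row with i rows below, added ones included, are
    cancelled by the last letters i+1 of the row above. So the surviving
    letters i come from above, where nothing relevant is added. *)
Lemma lows_pad i ms T : size ms = size T -> strict ms -> staircase T -> i.+1 < size T ->
  lows i (rd (pad 0 ms T)) = lows i (rd T).
Proof.
elim: ms T => [|m ms IH] [|r T] // [sz] st w; rewrite [size _]/= ltnS.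
have w' : staircase T by case/and4P: w.
have st' : strict ms := path_sorted st.
rewrite [pad _ _ _]/= addn0 2!rd_cons rev_cat rev_nseq -catA.
rewrite leq_eqVlt => /orP[/eqP sT|lt]; last first.
  by rewrite !sig_cat IH // sig_nseq_other //=; lia.
case: ms T sT sz st w w' st' {IH} => [|m' ms] [|r' T] // [sT] [sz] st w w' st'.
subst i; have wp := staircase_pad (m' :: ms) (r' :: T) (congr1 S sz) st' w'.
rewrite /= addn0 in wp.
rewrite [size (r' :: T)]/= [pad _ _ _]/= addn0.
rewrite !(sig_cat _ (rev r)) !(sig_cat _ (nseq _ _)) sig_nseq_high.
rewrite (sig_home _ _ _ w') // (sig_home _ _ _ wp) ?size_pad //.
case/and4P: w => h1 h2 h3 _; have := leading_high (size T) r r' h2 h1 h3.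
rewrite count_cat count_nseq /= eqxx mul1n.
by have := strict_leq _ _ _ st; lia.
Qed.

(** The second half of the condition [cut] passes to the padded tableau; b is
    the part of the row of the box which is read after the box. *)
Lemma lows_pad_suffix i b m ms T : size ms = size T -> strict (m :: ms) -> staircase T ->
  i < size T ->
  lows i (b ++ nseq m (size T) ++ rd (pad 0 ms T)) <= lows i (b ++ rd T).
Proof.
move=> sz st w; have st' : strict ms := path_sorted st.
rewrite leq_eqVlt => /orP[/eqP sT|lt]; last first.
  by rewrite !sig_cat lows_pad // sig_nseq_other //=; lia.
have wp := staircase_pad _ _ sz st' w.
case: ms T sT sz st w st' wp => [|m' ms] [|r' T] // [sT] [sz] st w st'.
subst i; rewrite /= addn0 => wp.
rewrite !(sig_cat _ b) !(sig_cat _ (nseq _ _)) sig_nseq_high (sig_home _ _ _ w) // (sig_home _ _ _ wp) ?size_pad //.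
rewrite count_cat count_nseq /= eqxx mul1n.
by have := strict_leq _ _ _ st; lia.
Qed.

Lemma sig_pad_above i k ms T : size ms = size T -> i.+1 < k ->
  sig i (rd (pad k ms T)) = sig i (rd T).
Proof.
move=> + ik; elim: ms T => [|m ms IH] [|r T] //= [sz].
rewrite !rd_cons rev_cat rev_nseq !sig_cat IH // sig_nseq_other //=; last first.
  exact: leq_trans ik (leq_addl _ _).
by congr pair; lia.
Qed.

Lemma all_pad_above k ms T : size ms = size T -> 1 < k ->
  all (leq 2) (rd (pad k ms T)) = all (leq 2) (rd T).
Proof.
move=> + ik; elim: ms T => [|m ms IH] [|r T] //= [sz].
rewrite !rd_cons rev_cat rev_nseq !all_cat IH // all_nseq.
by rewrite (leq_trans ik (leq_addl _ _)) orbT andbT.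
Qed.

(** * Operators on padded tableaux *)

Lemma mark_cat {n} (i : option 'I_n.-1) c x y :
  mark i c (x ++ c :: y) (size x) = cut i x y.
Proof.
rewrite /mark nth_cat ltnn subnn eqxx take_size_cat // size_cat /=.
by rewrite -cat_rcons drop_size_cat ?size_rcons // addnS ltnS leq_addr.
Qed.

Lemma cut_highs {n} (i : option 'I_n.-1) x y : cut i x y -> highs (lo i) x = 0.
Proof.
case: i => [k|] /=; first by case/andP=> /eqP.
move=> h; rewrite sig_free //; apply: sub_all h => c c2.
by rewrite !gtn_eqF // ltnW.
Qed.

(** A box that an operator changes lies above the last row in which its letter
    may occur: in that row all letters lo i are cancelled by the row above,
    by [leading_high]. *)
Lemma cut_row {n} (i : option 'I_n.-1) (b : bool) T1 r T2 x y y' :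
  staircase (T1 ++ r :: T2) -> (lo i).+1 < size (T1 ++ r :: T2) ->
  rev r = x ++ lo i + b :: y -> cut i (rd T1 ++ x) y' -> lo i < size T2.
Proof.
move=> w sT er /cut_highs; have w2 := staircase_cat _ _ w.
have := w2 => /= /and4P[h1 _ _ _].
have := h1; rewrite -all_rev er all_cat /= => /and3P[hx hc _].
case: b er hc => [|] er hc; first by rewrite addn1 in hc.
rewrite addn0 in er hc; move: hc; rewrite leq_eqVlt => /orP[/eqP el|//].
case/lastP: T1 w sT => [|T1 r0] w sT.
  by move: sT; rewrite /= el ltnn.
rewrite cat_rcons in w; have := staircase_cat _ _ w => /and4P[g1 g2 g3 _].
have := leading_high (lo i) r0 r g2; rewrite {1}el => /(_ g1 g3).
rewrite -cats1 rd_cat rd_cons cats0 -catA !sig_cat (sig_low _ x); last by rewrite el.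
by rewrite -count_rev er count_cat /= eqxx; lia.
Qed.

(** By [cut_row] the letters added above the box are too large to matter, and
    those added after it do not affect the condition by [lows_pad_suffix]. *)
Lemma raw_act_pad {n} (up : bool) (i : option 'I_n.-1) ms T T' :
  size ms = size T -> strict ms -> staircase T -> (lo i).+1 < size T ->
  raw_act up i T = Some T' -> raw_act up i (pad 0 ms T) = Some (pad 0 ms T').
Proof.
move=> sz st w sT /raw_actP[p mp ->].
have [pT /eqP np] := and3P mp.
have [T1 [r [T2 [a [b [eT er ep -> ->]]]]]] := rd_split pT.
rewrite np in er => cp; subst T.
have lt := cut_row _ _ _ _ _ _ _ _ w sT er cp.
rewrite (changeE T2 (lo i + ~~ up) er ep).
move: sz st; rewrite -(cat_take_drop (size T1) ms).
set ms1 := take _ _; set ms2 := drop _ _ => sz st.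
have sz1 : size ms1 = size T1.
  by rewrite size_takel // -(cat_take_drop (size T1) ms) sz size_cat leq_addr.
case: ms2 sz st => [|m ms2]; rewrite !size_cat sz1 => /addnI //= [sz] st.
have st2 : strict (m :: ms2).
  by move: st; rewrite /strict sorted_cat_cons => /andP[].
rewrite !pad_cat //= !addn0; set P1 := pad _ _ _.
have er' : rev (nseq m (size T2) ++ r) = a ++ lo i + up :: (b ++ nseq m (size T2)).
  by rewrite rev_cat er rev_nseq -catA.
apply/raw_actP; exists (size (rd P1 ++ a)); last first.
  rewrite (changeE _ (lo i + ~~ up) er') //.
  by congr (_ ++ _ :: _); rewrite -cat_cons catA [RHS]rev_cat rev_nseq.
rewrite rd_cat rd_cons er' -!catA /= -!catA catA mark_cat.
case: i lt cp {er er' ep np pT mp sT} => [k|] /= lt cp; last first.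
  by move: cp; rewrite !all_cat all_pad_above.
case/andP: cp => /eqP cp1 /eqP cp2; rewrite sig_cat sig_pad_above // -sig_cat cp1 /=.
have w2 : staircase T2 by case/and4P: (staircase_cat _ _ w).
by have := lows_pad_suffix k b m ms2 T2 sz st2 w2 lt; rewrite cp2 leqn0.
Qed.

(** * The poset of shapes *)

(* These state the coordinates with the ring structure of int displayed as lia
   recognizes it. *)
Lemma rV_addE n (u v : 'rV[int]_n) k : (u + v)%R 0%R k = (u 0%R k + v 0%R k : int)%R.
Proof. by rewrite mxE. Qed.

Lemma rV_oppE n (u : 'rV[int]_n) k : (- u)%R 0%R k = (- u 0%R k : int)%R.
Proof. by rewrite mxE. Qed.

Lemma lambda_negP n (v : 'rV[int]_n) :
  reflect ((forall k, v 0%R k <= 0)%R /\ forall i : 'I_n.-1,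
    (v 0%R (ilo i) <= v 0%R (ihi i))%R /\
    (v 0%R (ilo i) = v 0%R (ihi i) -> v 0%R (ilo i) = 0%R))
  (lambda_neg v).
Proof.
apply: (iffP andP) => [[/forallP h1 /forallP h2]|[h1 h2]]; split=> //.
- move=> i; have /andP[h3 /implyP h4] := h2 i; split; first by lia.
  by move=> e; have := h4 _; rewrite e eqxx => /(_ isT)/andP[/eqP].
- exact/forallP.
- apply/forallP => i; have [h3 h4] := h2 i; apply/andP; split; first by lia.
  by apply/implyP => /eqP e; rewrite -e h4 ?eqxx.
Qed.

Lemma lambda_neg0 n : lambda_neg (0 : 'rV[int]_n)%R.
Proof. by apply/lambda_negP; split=> [k|i]; rewrite !mxE. Qed.

Lemma lambda_negD n (u v : 'rV[int]_n) :
  lambda_neg u -> lambda_neg v -> lambda_neg (u + v)%R.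
Proof.
move=> /lambda_negP[u1 u2] /lambda_negP[v1 v2]; apply/lambda_negP.
split=> [k|i]; rewrite !rV_addE; first by have := u1 k; have := v1 k; lia.
have [u3 u4] := u2 i; have [v3 v4] := v2 i; split; first by lia.
move=> e; have eu : u 0%R (ilo i) = u 0%R (ihi i) by lia.
have ev : v 0%R (ilo i) = v 0%R (ihi i) by lia.
by rewrite (u4 eu) (v4 ev).
Qed.

Lemma lambda_le_directed n : directed_poset (@lambda_le n).
Proof.
split.
- by constructor; exists 0%R; apply: lambda_neg0.
- by move=> lam; rewrite /lambda_le GRing.subrr lambda_neg0.
- move=> lam mu /lambda_negP[h1 _] /lambda_negP[h2 _]; apply/val_inj/rowP => k.
  by have := h1 k; have := h2 k; rewrite !rV_addE !rV_oppE; lia.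
- move=> mu lam kap h1 h2; rewrite /lambda_le.
  by rewrite -(GRing.subrKA (val mu)); apply: lambda_negD.
- move=> lam mu.
  exists (Sub (val lam + val mu)%R (lambda_negD _ _ _ (valP lam) (valP mu)) : LambdaNeg n).
  rewrite /lambda_le /= GRing.addrK (valP lam); split => //.
  by rewrite GRing.addrC GRing.addKr (valP mu).
Qed.

Lemma nth_parts n (v : 'rV[int]_n) (k : 'I_n) : nth 0 (parts v) k = absz (v 0%R k).
Proof. by rewrite (nth_map k) ?size_enum_ord // nth_ord_enum. Qed.

Lemma strict_parts n (v : 'rV[int]_n) : lambda_neg v -> strict (parts v).
Proof.
move=> /lambda_negP[h1 h2]; apply/(sortedP 0) => j; rewrite size_parts => jn.
have jn' : j < n.-1 by lia.
have := nth_parts _ v (ilo (Ordinal jn')); have := nth_parts _ v (ihi (Ordinal jn')).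
rewrite /= => -> ->; have := h1 (ilo (Ordinal jn')); have := h1 (ihi (Ordinal jn')).
by have := h2 (Ordinal jn'); lia.
Qed.

Lemma parts_add n (u v : 'rV[int]_n) j : lambda_neg u -> lambda_neg v ->
  nth 0 (parts (u + v)%R) j = nth 0 (parts u) j + nth 0 (parts v) j.
Proof.
move=> /lambda_negP[h1 _] /lambda_negP[h2 _].
have [jn|nj] := ltnP j n; last by rewrite !nth_default ?size_parts.
rewrite !(nth_parts _ _ (Ordinal jn)) rV_addE.
by have := h1 (Ordinal jn); have := h2 (Ordinal jn); lia.
Qed.

(** * The crystals of tableaux *)

Definition act {n} {B : crystal n} (up : bool) (i : option 'I_n.-1) (b : B) : option B :=
  if up then cr_e i b else cr_f i b.

Definition tab {n} {lam : LambdaNeg n} (x : SDT_T lam) : seq (seq nat) := val x.1.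

Section Tableaux.
Variables (n : nat) (hn : 1 < n).
Implicit Types (lam mu kap : LambdaNeg n) (i j : option 'I_n.-1).

Lemma tab_inj lam : injective (@tab n lam).
Proof. by case=> [S []] [T []] /val_inj /= ->. Qed.

Lemma size_tab lam (x : SDT_T lam) : size (tab x) = n.
Proof. exact: is_SDT_size (valP x.1). Qed.

Lemma lo_lt i : (lo i).+1 < n.
Proof. by case: i => [k|] //=; apply: ihi_subproof. Qed.

(** As t_nu is killed by all operators and has epsilon and phi equal to -oo,
    tensoring with it does not interfere with the operators. *)
Lemma act_omap lam (up : bool) i (x : SDT_T lam) :
  act up i x = omap (fun T => (T, tt)) (if up then sdt_e i x.1 else sdt_f i x.1).
Proof.
case: x => T []; case: i => [k|]; case: up => //=; rewrite /queer_free /=;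
  by case: (sdt_e None T); case: (sdt_f None T).
Qed.

Lemma omap_tab_act lam up i (x : SDT_T lam) : omap tab (act up i x) = raw_act up i (tab x).
Proof.
rewrite act_omap; case: up; rewrite /raw_act -?sdt_eE -?sdt_fE //.
  by case: (sdt_e i x.1).
by case: (sdt_f i x.1).
Qed.

Lemma actP lam up i (x y : SDT_T lam) :
  act up i x = Some y <-> raw_act up i (tab x) = Some (tab y).
Proof.
rewrite -omap_tab_act; split=> [-> //|].
by case: (act up i x) => //= z [/tab_inj ->].
Qed.

Lemma phiE lam (k : 'I_n.-1) (x : SDT_T lam) :
  cr_phi k x = Some (Posz (lows k (rd (tab x)))).
Proof. by rewrite -size_unmatched. Qed.

Lemma epsE lam (k : 'I_n.-1) (x : SDT_T lam) :
  cr_eps k x = Some (Posz (highs k (rd (tab x))) - wti k (- w0_parts lam))%R.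
Proof. by rewrite -size_unmatched. Qed.

Lemma wtE lam (x : SDT_T lam) (j : 'I_n) :
  cr_wt x 0%R j = (Posz (count_mem (j : nat) (rd (tab x))) - w0_parts lam 0%R j)%R.
Proof. by rewrite !mxE. Qed.

Lemma act_inv lam up i (x y : SDT_T lam) : act up i x = Some y -> act (~~ up) i y = Some x.
Proof. by move=> /actP/raw_act_inv h; apply/actP. Qed.

Lemma alphaE k (a : 'I_n) :
  alpha n k 0%R a = (Posz (k == a) - Posz (k.+1 == a) : int)%R.
Proof. by rewrite mxE ![_ == nat_of_ord a]eq_sym; case: eqP; case: eqP. Qed.

Lemma act_wt lam (up : bool) i (x y : SDT_T lam) : act up i x = Some y ->
  cr_wt y = (cr_wt x + (if up then simple_root i else - simple_root i))%R.
Proof.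
move=> /actP/raw_actP[p mp e]; have [pT /eqP np _] := and3P mp.
have -> : simple_root i = alpha n (lo i) by case: (i).
apply/rowP => a; rewrite wtE rV_addE wtE e (rd_change _ _ _ pT).1.
have := count_set (rd (tab x)) p (lo i + ~~ up) a pT; rewrite np.
move: (count_mem _ _) (count_mem _ _) => c c'.
case: up {e mp np} => /=; rewrite ?rV_oppE alphaE addn0 addn1; lia.
Qed.

Lemma act_sig lam (up : bool) (k : 'I_n.-1) (x y : SDT_T lam) : act up (Some k) x = Some y ->
  lows k (rd (tab y)) + ~~ up = lows k (rd (tab x)) + up /\
  highs k (rd (tab y)) + up = highs k (rd (tab x)) + ~~ up.
Proof.
move=> /actP/raw_actP[p mp ->]; have [pT _ _] := and3P mp.
by rewrite (rd_change _ _ _ pT).1; apply: sig_set.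
Qed.

Lemma queer_sig lam (up : bool) (k : 'I_n.-1) (x y : SDT_T lam) : 1 < k ->
  act up None x = Some y -> sig k (rd (tab y)) = sig k (rd (tab x)).
Proof.
move=> k2 /actP/raw_actP[p mp ->]; have [pT /eqP np _] := and3P mp.
rewrite (rd_change _ _ _ pT).1; apply: sig_code; apply: map_code_set => //.
rewrite np /code /=; case: up {mp np}; rewrite /= ?addn0 ?addn1 ?add0n.
  by rewrite !ltn_eqF // ltnW // ltnW.
by rewrite !ltn_eqF // ltnW // ltnW.
Qed.

Lemma act_comm1 lam (up vp : bool) i j (x y : SDT_T lam) :
  code (lo j) (lo i) = (false, false) -> code (lo j) (lo i).+1 = (false, false) ->
  code (lo i) (lo j) = (false, false) -> code (lo i) (lo j).+1 = (false, false) ->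
  obind (act vp j) (act up i x) = Some y -> obind (act up i) (act vp j x) = Some y.
Proof.
move=> h1 h2 h3 h4; case E : (act up i x) => [z|] //= /actP h; move/actP: E => E.
have := raw_act_comm _ _ _ _ _ _ _ h1 h2 h3 h4 E h.
rewrite -omap_tab_act; case: (act vp j x) => //= t ht; exact/actP.
Qed.

Lemma act_queer_comm lam (up vp : bool) (k : 'I_n.-1) (x : SDT_T lam) : 1 < k ->
  obind (act up (Some k)) (act vp None x) = obind (act vp None) (act up (Some k) x).
Proof.
move=> k2; have c0 : code 0 k = (false, false) /\ code 0 k.+1 = (false, false).
  by rewrite /code !gtn_eqF // ltnW // ltnW.
have ck : code k 0 = (false, false) /\ code k 1 = (false, false).
  by rewrite /code !ltn_eqF // ltnW // ltnW.
case: c0 ck => c0 c0' [ck ck'].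
case E : (obind (act up (Some k)) _) => [y|].
  by apply/esym; apply: act_comm1 E.
case E' : (obind (act vp None) _) => [y|//].
by rewrite -E; apply: act_comm1 E'.
Qed.

Lemma SDT_T_q_crystal lam : is_q_crystal (- w0_parts lam)%R (SDT_T lam).
Proof.
have phi_eps (k : 'I_n.-1) (x : SDT_T lam) : cr_phi k x = zadd (cr_eps k x) (wti k (cr_wt x)).
  rewrite phiE epsE /wti !wtE !rV_oppE /=; congr Some.
  have := sig_balance k (rd (tab x)).
  by move: (highs k _) (lows k _) (count_mem _ _) (count_mem _ _); lia.
split; first split.
- by move=> k x y /(act_wt lam true).
- by move=> k x y /(act_wt lam false).
- exact: phi_eps.
- by move=> k x y; split; [apply: (act_inv lam false) | apply: (act_inv lam true)].
- move=> k x y /(act_sig lam true) h; rewrite !phiE !epsE; move: h => /= [h1 h2].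
  by split; congr Some; lia.
- move=> k x y /(act_sig lam false) h; rewrite !phiE !epsE; move: h => /= [h1 h2].
  by split; congr Some; lia.
- by move=> k x; rewrite phiE.
- by move=> x a; rewrite wtE rV_oppE; lia.
- by move=> x y /(act_wt lam true).
- by move=> x y /(act_wt lam false).
- by move=> x y; split; [apply: (act_inv lam false) | apply: (act_inv lam true)].
- move=> k x k2; split; [exact: (act_queer_comm lam true true) |
    exact: (act_queer_comm lam false true) | exact: (act_queer_comm lam true false) |
    exact: (act_queer_comm lam false false)].
- move=> k x y k2 /(queer_sig lam true _ _ _ k2) e.
  by rewrite !phiE !epsE e.
Qed.

End Tableaux.

(** * The embeddings *)

Lemma pad_comp k ms1 ms2 ms T :
  size ms1 = size T -> size ms2 = size T -> size ms = size T ->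
  (forall j, nth 0 ms j = nth 0 ms2 j + nth 0 ms1 j) ->
  pad k ms2 (pad k ms1 T) = pad k ms T.
Proof.
move=> s1 s2 s e; apply: (@eq_from_nth _ [::]); rewrite !size_pad // => j jT.
by rewrite !nth_pad ?size_pad // e nseqD catA.
Qed.

Lemma pad_inj k ms T1 T2 : size ms = size T1 -> size ms = size T2 ->
  pad k ms T1 = pad k ms T2 -> T1 = T2.
Proof.
elim: ms T1 T2 => [|m ms IH] [|r1 T1] [|r2 T2] //= [s1] [s2].
rewrite -s1 -s2 => -[] e /IH -> //.
by move/(congr1 (drop (size (nseq m (size ms + k))))): e; rewrite !drop_size_cat // => ->.
Qed.

Lemma count_pad a ms T : size ms = size T ->
  count_mem a (rd (pad 0 ms T)) =
  count_mem a (rd T) + (if a < size T then nth 0 ms (size T - a.+1) else 0).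
Proof.
elim: ms T => [|m ms IH] [|r T] //= [sz].
rewrite !rd_cons rev_cat rev_nseq !count_cat IH // count_nseq ltnS.
rewrite /= addn0 [size T == a]eq_sym; case: (ltngtP a (size T)) => [lt|_|->] /=.
- by rewrite subSn //=; lia.
- by lia.
- by rewrite mul1n subnn /=; lia.
Qed.

Section Embeddings.
Variables (n : nat) (hn : 1 < n).

Lemma upsilonP (lam kap : LambdaNeg n) (le : lambda_le lam kap) (x : SDT_T lam) :
  exists2 y : SDT_T kap, @upsilon n lam kap le x = Some y &
    tab y = pad 0 (parts (val kap - val lam)%R) (tab x).
Proof.
have sT := size_tab _ _ x; rewrite /upsilon add_boxes_pad //.
set ms := parts _; have sz : size ms = size (tab x) by rewrite size_parts sT.
have := valP x.1; rewrite is_SDTE -[val x.1]/(@tab n lam x) => /andP[/eqP sh w].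
have ok : is_SDT (val kap) (pad 0 ms (tab x)).
  rewrite is_SDTE staircase_pad ?andbT ?strict_parts //; apply/eqP.
  apply: (@eq_from_nth _ 0); rewrite size_map size_pad // ?size_parts // => j jT.
  rewrite (nth_map [::]) ?size_pad // nth_pad // size_cat size_nseq.
  have -> : size (nth [::] (tab x) j) = nth 0 (parts (val lam)) j.
    by rewrite -sh (nth_map [::]).
  by rewrite -(parts_add _ _ _ _ le (valP lam)) GRing.subrK.
by exists (Sub (pad 0 ms (tab x)) ok, tt); rewrite ?insubT.
Qed.

Lemma upsilon_tab (lam kap : LambdaNeg n) (le : lambda_le lam kap) (x : SDT_T lam) (y : SDT_T kap) :
  @upsilon n lam kap le x = Some y ->
  tab y = pad 0 (parts (val kap - val lam)%R) (tab x).
Proof. by have [z -> e] := upsilonP _ _ le x => -[<-]. Qed.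

Lemma staircase_tab (lam : LambdaNeg n) (x : SDT_T lam) : staircase (tab x).
Proof. by have := valP x.1; rewrite is_SDTE => /andP[]. Qed.

Lemma upsilon_act (lam kap : LambdaNeg n) (le : lambda_le lam kap) up i (x x' : SDT_T lam) (y : SDT_T kap) :
  act up i x = Some x' -> @upsilon n lam kap le x = Some y ->
  act up i y = @upsilon n lam kap le x'.
Proof.
move=> /(actP n hn) ax /upsilon_tab ty; have [y' -> ty'] := upsilonP _ _ le x'.
apply/(actP n hn); rewrite ty ty'; apply: raw_act_pad => //.
- by rewrite size_parts size_tab.
- exact: strict_parts.
- exact: staircase_tab.
- by rewrite size_tab; apply: lo_lt.
Qed.

Lemma upsilon_wt (lam kap : LambdaNeg n) (le : lambda_le lam kap) (x : SDT_T lam) (y : SDT_T kap) :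
  @upsilon n lam kap le x = Some y -> cr_wt y = cr_wt x.
Proof.
move=> /upsilon_tab ty; apply/rowP => a; rewrite !wtE ty.
have sz : size (parts (val kap - val lam)%R) = size (tab x) by rewrite size_parts size_tab.
rewrite count_pad // size_tab ltn_ord.
have -> : n - a.+1 = rev_ord a by [].
have /lambda_negP[/(_ (rev_ord a)) d0 _] := le.
rewrite nth_parts; move: d0; rewrite rV_addE rV_oppE.
have w0E (nu : LambdaNeg n) : w0_parts nu 0%R a = (- val nu 0%R (rev_ord a) : int)%R.
  by rewrite mxE.
rewrite !w0E; move: (val kap _ _) (val lam _ _) (count_mem _ _) => b c d; lia.
Qed.

Lemma upsilon_phi (lam kap : LambdaNeg n) (le : lambda_le lam kap) (k : 'I_n.-1) (x : SDT_T lam)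
    (y : SDT_T kap) :
  @upsilon n lam kap le x = Some y -> cr_phi k y = cr_phi k x.
Proof.
move=> /upsilon_tab ty; rewrite !phiE ty lows_pad //.
- by rewrite size_parts size_tab.
- exact: strict_parts.
- exact: staircase_tab.
- by rewrite size_tab; apply: ihi_subproof.
Qed.

(** Both sides satisfy phi = epsilon + wt_i, so this follows from the
    preservation of phi and of the weight. *)
Lemma upsilon_eps (lam kap : LambdaNeg n) (le : lambda_le lam kap) (k : 'I_n.-1) (x : SDT_T lam)
    (y : SDT_T kap) :
  @upsilon n lam kap le x = Some y -> cr_eps k y = cr_eps k x.
Proof.
move=> e; have := upsilon_phi _ _ _ k _ _ e.
rewrite (gl_phi_eps (q_gl (SDT_T_q_crystal n hn kap)) k y).
rewrite (gl_phi_eps (q_gl (SDT_T_q_crystal n hn lam)) k x) (upsilon_wt _ _ _ _ _ e).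
by rewrite !epsE => -[/GRing.addIr ->].
Qed.

Lemma upsilon_embedding (lam kap : LambdaNeg n) (le : lambda_le lam kap) : is_embedding (@upsilon n lam kap le).
Proof.
have tot (x : SDT_T lam) : exists y, @upsilon n lam kap le x = Some y.
  by have [y e _] := upsilonP _ _ le x; exists y.
have mor (up : bool) i (x : SDT_T lam) :
    obind (@upsilon n lam kap le) (act up i x) <> None ->
    obind (@upsilon n lam kap le) (act up i x) = obind (act up i) (@upsilon n lam kap le x).
  case E : (act up i x) => [x'|] //= _; have [y ey] := tot x.
  by rewrite ey /= (upsilon_act _ _ _ _ _ _ _ _ E ey).
split; first split.
- exact: upsilon_wt.
- by move=> k x y e; split; [apply: upsilon_eps e | apply: upsilon_phi e].
- by move=> i x h _; apply: (mor true).
- by move=> i x h _; apply: (mor false).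
- case=> [x|] [x'|] //=.
  + have [y e t] := upsilonP _ _ le x; have [y' e' t'] := upsilonP _ _ le x'.
    rewrite e e' => -[yy]; congr Some; apply: tab_inj.
    by apply: (pad_inj 0 (parts (val kap - val lam)%R));
      rewrite ?size_parts ?size_tab // -t -t' yy.
  + by have [y ->] := tot x.
  + by have [y ->] := tot x'.
Qed.

Lemma upsilon_id (lam : LambdaNeg n) (le : lambda_le lam lam) (x : SDT_T lam) :
  @upsilon n lam lam le x = Some x.
Proof.
have [y -> t] := upsilonP _ _ le x; congr Some; apply: tab_inj; rewrite t GRing.subrr.
have sz : size (parts (0 : 'rV[int]_n)%R) = size (tab x) by rewrite size_parts size_tab.
apply: (@eq_from_nth _ [::]); rewrite size_pad // => j jT.
rewrite nth_pad //; rewrite size_tab in jT.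
by rewrite (nth_parts _ _ (Ordinal jT)) mxE.
Qed.

Lemma upsilon_comp (lam mu kap : LambdaNeg n) (lm : lambda_le lam mu) (mk : lambda_le mu kap)
    (lk : lambda_le lam kap) (x : SDT_T lam) :
  obind (@upsilon n mu kap mk) (@upsilon n lam mu lm x) = @upsilon n lam kap lk x.
Proof.
have [y -> ty] := upsilonP _ _ lm x; have [z ez tz] := upsilonP _ _ mk y.
have [z' -> tz'] := upsilonP _ _ lk x; rewrite /= ez; congr Some; apply: tab_inj.
rewrite tz tz' ty; apply: pad_comp; rewrite ?size_parts ?size_tab // => j.
by rewrite -parts_add // GRing.subrKA.
Qed.

End Embeddings.

Theorem corollary3p13 (n : nat) (hn : 2 <= n) :
  @directed_system n (LambdaNeg n) (@lambda_le n)
    (fun lam => (- w0_parts lam)%R) (fun lam => SDT_T lam) (@upsilon n).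
Proof.
split.
- exact: lambda_le_directed.
- exact: SDT_T_q_crystal.
- exact: upsilon_embedding.
- exact: upsilon_id.
- exact: upsilon_comp.
Qed.
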